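(* There exists a polynomial-time algorithm that solves the black-and-white coloring problem on distance-hereditary graphs; that is, given a distance-hereditary graph $G$ and integers $b$ and $w$, the algorithm decides in time polynomial in the number of vertices of $G$ whether $G$ has a black-and-white coloring with $b$ black vertices and $w$ white vertices.
   Context: Graphs are finite, simple and undirected. A black-and-white coloring of a graph $G=(V,E)$ with $b$ black and $w$ white vertices is a pair of disjoint sets $B,W\subseteq V$ (the black and the white vertices) with $|B|=b$ and $|W|=w$ such that no vertex of $B$ is adjacent to any vertex of $W$; the vertices outside $B\cup W$ are uncolored. The black-and-white coloring problem takes as input a graph $G$ and integers $b$ and $w$ and asks whether such a coloring exists. A graph $G$ is distance hereditary if for every pair of nonadjacent vertices $x$ and $y$ and for every connected induced subgraph $H$ of $G$ which contains $x$ and $y$, the distance between $x$ and $y$ in $H$ is the same as the distance between $x$ and $y$ in $G$. *)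

(* Defs.v *)
From mathcomp Require Import all_boot all_order all_algebra.

Set Implicit Arguments.
Unset Strict Implicit.
Unset Printing Implicit Defensive.


Record sgraph (T : finType) := SGraph {
  adj :> rel T;
  adj_sym : symmetric adj;
  adj_irr : irreflexive adj
}.

Section Graphs.
Variable T : finType.
Implicit Types (G : sgraph T) (S B W : {set T}).

Definition induced_adj G S : rel {x : T | x \in S} :=
  fun x y => adj G (val x) (val y).

Lemma induced_sym G S : symmetric (@induced_adj G S).
Proof. by move=> x y; apply: adj_sym. Qed.

Lemma induced_irr G S : irreflexive (@induced_adj G S).
Proof. by move=> x; apply: adj_irr. Qed.

Definition induced G S : sgraph {x : T | x \in S} :=
  SGraph (@induced_sym G S) (@induced_irr G S).

Definition connected G : Prop := forall x y : T, connect G x y.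

Definition has_walk G (x y : T) (k : nat) : bool :=
  [exists p : k.-tuple T, path G x p && (last x p == y)].

(* A shortest walk has fewer than #|T| edges, so the value #|T| stands for an
   infinite distance. *)
Definition distance G (x y : T) : nat := find (has_walk G x y) (iota 0 #|T|).

End Graphs.

Definition distance_hereditary (T : finType) (G : sgraph T) : Prop :=
  forall (S : {set T}) (x y : {x : T | x \in S}),
    connected (induced G S) -> ~~ G (val x) (val y) ->
    distance (induced G S) x y = distance G (val x) (val y).

Definition bw_coloring (T : finType) (G : sgraph T) (b w : int)
    (B W : {set T}) : Prop :=
  [/\ [disjoint B & W], Posz #|B| = b, Posz #|W| = w
    & forall x y, x \in B -> y \in W -> ~~ G x y].

(* The model of computation is a random access machine, programmed with
   structured control flow: integer registers and integer arrays, both named by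
   numerals fixed in the program, the arrays being unbounded and indexed by
   computed integers.  Every operation costs one unit of time.  Addition and
   subtraction are the only arithmetic operations: a number gains at most one
   bit per operation, so running times are polynomially related to those of
   Turing machines, which unit-cost multiplication would break. *)
Inductive expr :=
  | Const of int
  | Reg of nat
  | Read of nat & expr
  | Add of expr & expr
  | Sub of expr & expr
  | Leq of expr & expr.

Inductive cmd :=
  | Skip
  | Assign of nat & expr
  | Write of nat & expr & expr
  | Seq of cmd & cmd
  | If of expr & cmd & cmd
  | While of expr & cmd.

Record state := State { reg : nat -> int; arr : nat -> int -> int }.

Definition set_reg (s : state) (r : nat) (v : int) : state :=
  State (fun r' => if r' == r then v else reg s r') (arr s).

Definition set_arr (s : state) (a : nat) (i v : int) : state :=
  State (reg s)
    (fun a' i' => if (a' == a) && (i' == i) then v else arr s a' i').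

Fixpoint eval (s : state) (e : expr) : int :=
  match e with
  | Const c => c
  | Reg r => reg s r
  | Read a e1 => arr s a (eval s e1)
  | Add e1 e2 => (eval s e1 + eval s e2)%R
  | Sub e1 e2 => (eval s e1 - eval s e2)%R
  | Leq e1 e2 => if (eval s e1 <= eval s e2)%R then 1%R else 0%R
  end.

Fixpoint cost (e : expr) : nat :=
  match e with
  | Const _ | Reg _ => 1
  | Read _ e1 => (cost e1).+1
  | Add e1 e2 | Sub e1 e2 | Leq e1 e2 => (cost e1 + cost e2).+1
  end.

(* [exec c s t s']: started in s, the program c halts in s' after time t. *)
Inductive exec : cmd -> state -> nat -> state -> Prop :=
  | ExecSkip s : exec Skip s 1 s
  | ExecAssign s r e :
      exec (Assign r e) s (cost e).+1 (set_reg s r (eval s e))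
  | ExecWrite s a e1 e2 :
      exec (Write a e1 e2) s (cost e1 + cost e2).+1
        (set_arr s a (eval s e1) (eval s e2))
  | ExecSeq c1 c2 s s1 s2 t1 t2 :
      exec c1 s t1 s1 -> exec c2 s1 t2 s2 ->
      exec (Seq c1 c2) s (t1 + t2) s2
  | ExecIfTrue e c1 c2 s s' t :
      eval s e <> 0%R -> exec c1 s t s' ->
      exec (If e c1 c2) s (cost e + t).+1 s'
  | ExecIfFalse e c1 c2 s s' t :
      eval s e = 0%R -> exec c2 s t s' ->
      exec (If e c1 c2) s (cost e + t).+1 s'
  | ExecWhileTrue e c s s1 s2 t1 t2 :
      eval s e <> 0%R -> exec c s t1 s1 -> exec (While e c) s1 t2 s2 ->
      exec (While e c) s (cost e + t1 + t2).+1 s2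
  | ExecWhileFalse e c s :
      eval s e = 0%R -> exec (While e c) s (cost e).+1 s.

Lemma exec_deterministic c s t1 s1 t2 s2 :
  exec c s t1 s1 -> exec c s t2 s2 -> t1 = t2 /\ s1 = s2.
Proof.
move=> H; elim: H t2 s2 => {c s t1 s1};
  intros; match goal with H : exec _ _ _ _ |- _ /\ _ = ?s2 =>
    match type of H with exec _ _ _ s2 => inversion H; subst => // end end;
  repeat match goal with
    IH : forall _ _, exec ?c ?s _ _ -> _, K : exec ?c ?s ?t ?s' |- _ =>
      case: (IH t s' K) => ? ?; clear IH K; subst end;
  by [].
Qed.

(* Registers 0, 1, 2 hold the number of vertices, b and w; array 0 holds the
   adjacency matrix in row-major order. *)
Definition input (n : nat) (G : sgraph 'I_n) (b w : int) : state :=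
  State
    (fun r => match r with 0 => Posz n | 1 => b | 2 => w | _ => 0%R end)
    (fun a k =>
       if (a == 0) &&
          [exists i : 'I_n, exists j : 'I_n, G i j && (k == Posz (i * n + j))]
       then 1%R else 0%R).

Definition accepting (s : state) : Prop := reg s 0 <> 0%R.

(* Main.v *)
(* A distance-hereditary graph on at least two vertices has vertices u <> v such
   that u and v are twins or u is the only possible neighbour of v.  Indeed every
   induced path is a geodesic; take the levels of a breadth-first search.  If two
   vertices of the last level have the same upper neighbours, then all vertices of
   that level with these upper neighbours form a module.  Otherwise let x have the
   fewest upper neighbours in the last level: these form a module, unless there is
   only one and x is pendant.  A module with a common neighbour is P4-free, and a
   P4-free set contains twins because it is cut by a uniform bipartition.

   Pruning v and recording it at u, the graph is at any time the union of blocks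
   H u, one for each remaining vertex u, where H u and H v are completely joined
   along their subsets S u and S v if u and v are adjacent, and there is no edge
   between them otherwise.  For each block the algorithm keeps the set of pairs
   (number of black vertices, number of white vertices) of its colorings,
   according to the colors that occur in S u; these sets determine those of a
   merged block. *)

From Stdlib Require Import Setoid.
Require Import Defs.
From mathcomp Require Import all_boot all_order all_algebra.
Import Order.TTheory GRing.Theory Num.Theory.

Set Implicit Arguments.
Unset Strict Implicit.
Unset Printing Implicit Defensive.

(** * Twins in P4-free graphs *)

Section Cographs.
Variable T : finType.
Implicit Types (e : rel T) (A C : {set T}).

(** No induced path on four vertices, in positive form: such a path without short chords closes to a
    cycle. Distinctness is explicit because the relation may have loops, as [co e] does when [e] is
    irreflexive. *)
Definition p4_free e C := forall a b c d,
  [&& a \in C, b \in C, c \in C & d \in C] -> uniq [:: a; b; c; d] ->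
  e a b -> e b c -> e c d -> ~~ e a c -> ~~ e b d -> e a d.

(** For [k = false] the set [C] is disconnected, for [k = true] its complement is. *)
Definition uniform_cut e C A (k : bool) :=
  [/\ A \subset C, A != set0, C :\: A != set0
    & forall x y, x \in A -> y \in C :\: A -> e x y = k].

Definition co e : rel T := fun x y => ~~ e x y.

Lemma sym_co e : symmetric e -> symmetric (co e).
Proof. by move=> es x y; rewrite /co es. Qed.

(** The path on four vertices is self-complementary: [a, b, c, d] in the complement is [c, a, d, b]
    in [e]. *)
Lemma p4_free_co e C : symmetric e -> p4_free e C -> p4_free (co e) C.
Proof.
move=> es free a b c d /and4P[aC bC cC dC] abcd nab nbc ncd; rewrite /co !negbK.
move=> ac bd; apply/negP => ad; move: nbc; rewrite /co es => /negP; apply.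
move: abcd; rewrite /= !inE !negb_or => /and4P[/and3P[ab a_c a_d] /andP[b_c b_d] c_d _].
apply: (free c a d b); rewrite ?aC ?bC ?cC ?dC //=.
- rewrite !inE !negb_or c_d ab a_d (eq_sym c a) a_c (eq_sym c b) b_c.
  by rewrite (eq_sym d b) b_d.
- by rewrite es.
- by rewrite es.
Qed.

Lemma uniform_cut_co e C A k :
  uniform_cut (co e) C A k -> uniform_cut e C A (~~ k).
Proof. by case=> ? ? ? cut; split=> // x y xA yA; rewrite -(cut x y) ?negbK. Qed.

(* The non-neighbours of x in A are cut off: if one of them, a, is adjacent to a
   neighbour z of x in A, then a, z, x, b is an induced path. *)
Lemma uniform_cut_refine e C x A b y : symmetric e -> p4_free e C ->
  x \in C -> uniform_cut e (C :\ x) A false ->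
  b \in (C :\ x) :\: A -> e x b -> y \in A -> ~~ e x y ->
  exists A', uniform_cut e C A' false.
Proof.
move=> es free xC [AC _ _ cut] bB xb yA xy.
have AE z : z \in A -> (z != x) && (z \in C).
  by move=> /(subsetP AC); rewrite !inE.
exists [set a in A | ~~ e x a]; split.
- by apply/subsetP=> z; rewrite !inE => /andP[/AE/andP[]].
- by apply/set0Pn; exists y; rewrite !inE yA.
- apply/set0Pn; exists x; rewrite !inE xC andbT negb_and.
  by apply/orP; left; apply/negP => /AE; rewrite eqxx.
move=> a z; rewrite !inE => /andP[aA xa] /andP[]; rewrite negb_and negbK.
case: (eqVneq z x) => [-> _ _|zx]; first by rewrite es; apply/negbTE.
have [zA /= xz zC|zA _ zC] := boolP (z \in A); last first.
  by apply: cut => //; rewrite !inE zA zx.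
apply/negbTE/negP => az; suff: e a b by rewrite (cut a b aA bB).
case/andP: (AE a aA) => ax aC.
move: bB; rewrite !inE => /and3P[bA bx bC].
have neb t : t \in A -> t != b by apply: contraTneq => ->.
apply: (free a z x b); rewrite ?aC ?zC ?xC ?bC //=.
- rewrite !inE !negb_or ax zx (eq_sym x b) bx !andbT /=.
  rewrite !neb // !andbT; apply: contraNneq xa => ->.
  by rewrite xz.
- by rewrite es.
- by rewrite es.
- by rewrite (cut z b) // !inE bA bx.
Qed.

(** If [x] has no neighbour on one side of the cut, that side is still cut off. If [x] is adjacent
    to everything, cut off [x] itself with [k = true]. Otherwise a non-neighbour of [x] lies on one
    side and a neighbour on the other, and that side is refined. *)
Lemma uniform_cut_add e C x A : symmetric e -> p4_free e C ->
  x \in C -> uniform_cut e (C :\ x) A false ->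
  exists A' k, uniform_cut e C A' k.
Proof.
move=> es free xC cutA; have [AC A0 B0 cut] := cutA.
have AE z : z \in A -> (z != x) && (z \in C).
  by move=> /(subsetP AC); rewrite !inE.
set B := (C :\ x) :\: A.
have cutB : uniform_cut e (C :\ x) B false.
  have BA : (C :\ x) :\: B = A by rewrite setDDr setDv set0U; apply/setIidPr.
  split; rewrite ?BA //; first exact: subsetDl.
  by move=> y z yB zA; rewrite es; apply: cut.
have [/existsP[a /andP[aA xa]]|/existsPn noA] := boolP [exists a, (a \in A) && e x a];
  last first.
  exists A, false; split=> //.
  - by apply/subsetP => z /AE/andP[].
  - by apply/set0Pn; exists x; rewrite inE xC andbT; apply/negP=> /AE; rewrite eqxx.
  move=> a y aA; rewrite !inE => /andP[yA yC].
  case: (eqVneq y x) => [->|yx]; last by apply: cut => //; rewrite !inE yA yx.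
  by rewrite es; apply/negbTE; move: (noA a); rewrite aA.
have [/existsP[b /andP[bB xb]]|/existsPn noB] := boolP [exists b, (b \in B) && e x b];
  last first.
  exists B, false; split=> //.
  - by apply/subsetP => z; rewrite !inE => /and3P[].
  - by apply/set0Pn; exists x; rewrite !inE eqxx xC andbF.
  move=> b y bB; rewrite !inE => /andP[yB yC].
  case: (eqVneq y x) => [->|yx].
    by rewrite es; apply/negbTE; move: (noB b); rewrite bB.
  by rewrite es; apply: cut => //; move: yB; rewrite yx yC !andbT negbK.
have [/existsP[y /andP[yC xy]]|/existsPn all1] :=
  boolP [exists y, (y \in C :\ x) && ~~ e x y]; last first.
  exists [set x], true; split.
  - by rewrite sub1set.
  - by apply/set0Pn; exists x; rewrite inE.
  - by apply/set0Pn; exists a; case/andP: (AE a aA) => ax aC; rewrite !inE ax.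
  move=> y z /set1P -> zC; move: (all1 z); move: zC; rewrite !inE => -> /=.
  by rewrite negbK.
have [yA|yB] := boolP (y \in A).
  by have [A' ?] := uniform_cut_refine es free xC cutA bB xb yA xy; exists A', false.
have yB' : y \in B by rewrite inE yB.
have aB : a \in (C :\ x) :\: B by rewrite !inE aA /= AE.
by have [A' ?] := uniform_cut_refine es free xC cutB aB xa yB' xy; exists A', false.
Qed.

Lemma p4_free_sub e A C : A \subset C -> p4_free e C -> p4_free e A.
Proof.
move=> /subsetP AC free a b c d /and4P[? ? ? ?].
by apply: free; rewrite !AC.
Qed.

(** Seinsche's theorem, by induction on removing a vertex [x]. A cut of [C :\ x] with [k = true] is
    treated in the complement, which is P4-free too. *)
Lemma p4_free_uniform_cut e C : symmetric e -> p4_free e C -> 1 < #|C| ->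
  exists A k, uniform_cut e C A k.
Proof.
have [m] := ubnP #|C|; elim: m C e => // m IH C e ltC es free C2.
have /card_gt0P[x xC] : 0 < #|C| by apply: ltnW.
have := cardsD1 x C; rewrite xC add1n => cardC.
have free' := p4_free_sub (subsetDl C [set x]) free.
have [C'2|C'1] := ltnP 1 #|C :\ x|.
  rewrite cardC in ltC.
  have [A [[] cut]] := IH _ _ ltC es free' C'2.
    have cut_co : uniform_cut (co e) (C :\ x) A false.
      by case: cut => ? ? ? cut; split=> // y z yA zA; rewrite /co (cut y z).
    have [A' [k cut']] := uniform_cut_add (sym_co es) (p4_free_co es free) xC cut_co.
    by exists A', (~~ k); apply: uniform_cut_co.
  exact: uniform_cut_add es free xC cut.
have /cards1P[y yE] : #|C :\ x| == 1 by rewrite eqn_leq C'1; rewrite cardC in C2.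
exists [set x], (e x y); split; rewrite ?yE ?sub1set //.
- by apply/set0Pn; exists x; rewrite inE.
- by apply/set0Pn; exists y; rewrite inE.
by move=> a b /set1P -> /set1P ->.
Qed.

(** True and false twins alike: the pair [u], [v] itself is left open. *)
Definition twins e C (u v : T) :=
  [forall x in C, (x != u) && (x != v) ==> (e u x == e v x)].

Lemma twinsP e C u v :
  reflect (forall x, x \in C -> x != u -> x != v -> e u x = e v x) (twins e C u v).
Proof.
apply: (iffP forall_inP) => [tw x xC xu xv|tw x xC].
  by apply/eqP; apply: (implyP (tw x xC)); rewrite xu.
by apply/implyP => /andP[xu xv]; rewrite tw.
Qed.

(** Each side of a uniform cut is a module, and twins inside a module are twins in [C]; so induct on
    a side with two vertices. If both sides are singletons, their two elements are all of [C]. *)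
Lemma p4_free_twins e C : symmetric e -> p4_free e C -> 1 < #|C| ->
  exists u v, [/\ u \in C, v \in C, u != v & twins e C u v].
Proof.
move=> es; have [m] := ubnP #|C|; elim: m C => // m IH C ltC free C2.
have [A [k [AC A0 B0 cut]]] := p4_free_uniform_cut es free C2.
have key (D : {set T}) : D \proper C -> 1 < #|D| ->
    (forall z, z \in C :\: D -> exists k', forall d, d \in D -> e d z = k') ->
    exists u v, [/\ u \in C, v \in C, u != v & twins e C u v].
  move=> DC D2 mod.
  have ltD : #|D| < m by apply: leq_trans (proper_card DC) _.
  have [u [v [uD vD uv /twinsP tw]]] :=
    IH D ltD (p4_free_sub (proper_sub DC) free) D2.
  exists u, v; split; rewrite ?(subsetP (proper_sub DC)) //.
  apply/twinsP => x xC xu xv; have [xD|xD] := boolP (x \in D); first exact: tw.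
  have /mod[k' kE] : x \in C :\: D by rewrite inE xD.
  by rewrite !kE.
have BC : C :\: A \subset C by apply: subsetDl.
have CBA : C :\: (C :\: A) = A by rewrite setDDr setDv set0U; apply/setIidPr.
have [A2|A1] := ltnP 1 #|A|.
  apply: (key A) => //; first by rewrite properE AC -setD_eq0 B0.
  by move=> z zB; exists k => d dA; apply: cut.
have [B2|B1] := ltnP 1 #|C :\: A|.
  apply: (key (C :\: A)) => //; first by rewrite properE BC -setD_eq0 CBA A0.
  by rewrite CBA => z zA; exists k => d dA; rewrite es; apply: cut.
have /cards1P[a aE] : #|A| == 1 by rewrite eqn_leq A1 card_gt0.
have /cards1P[b bE] : #|C :\: A| == 1 by rewrite eqn_leq B1 card_gt0.
have aA : a \in A by rewrite aE inE.
have : b \in C :\: A by rewrite bE inE.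
rewrite inE => /andP[bA bC].
exists a, b; split=> //; first exact: (subsetP AC).
  by apply: contraNneq bA => <-.
apply/twinsP => x xC xa xb; move: (setID C A) => CE.
move: xC; rewrite -CE bE !inE (negbTE xb) orbF aE !inE (negbTE xa) andbF //.
Qed.

End Cographs.

(** * Induced paths are geodesics *)

Section Geodesics.
Variables (T : finType) (G : sgraph T).

(** [x :: p] is an induced path. *)
Fixpoint chordless (x : T) (p : seq T) : bool :=
  if p is y :: p' then
    [&& G x y, all (fun z => (z != x) && ~~ G x z) p' & chordless y p']
  else true.

Lemma chordless_path x p : chordless x p -> path G x p.
Proof. by elim: p x => //= y p IH x /and3P[-> _ /IH]. Qed.

Lemma chordless_uniq x p : chordless x p -> uniq (x :: p).
Proof.
elim: p x => // y p IH x /= /and3P[xy /allP xp /IH /= ->].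
rewrite andbT inE negb_or (contraTneq _ xy) => [/=|<-]; last by rewrite adj_irr.
by apply/negP => /xp; rewrite eqxx.
Qed.

(** Limits the progress of a walk inside an induced path: each edge advances by at most one
    position. *)
Lemma chordless_index x p y z : chordless x p -> y \in x :: p -> z \in x :: p ->
  G y z -> index z (x :: p) <= (index y (x :: p)).+1.
Proof.
elim: p x => [|t p IH] x.
  by move=> _ /[!inE] /eqP-> /eqP->; rewrite adj_irr.
move=> cp; have /= /andP[xp _] := chordless_uniq cp.
case/and3P: cp => xt /allP xp' cp; rewrite inE => yp; rewrite inE => zp yz.
rewrite /= ![x == _]eq_sym; case: (eqVneq z x) zp yz => // zx /= zp yz.
case: (eqVneq y x) yp yz => [-> _ xz|yx /= yp yz]; last exact: IH.
move: zp; rewrite inE => /predU1P[->|/xp']; first by rewrite /= eqxx.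
by rewrite xz andbF.
Qed.

Lemma last_index (x : T) p : uniq (x :: p) -> index (last x p) (x :: p) = size p.
Proof. by move=> up; rewrite (last_nth x) index_uniq. Qed.

Lemma path_connect_induced (S : {set T}) x p (xS : x \in S) z (zS : z \in S) :
  path G x p -> {subset p <= S} -> z \in x :: p ->
  connect (induced G S) (Sub x xS) (Sub z zS).
Proof.
elim: p x xS => [|y p IH] x xS /=.
  by move=> _ _ /[!inE] /eqP zx; apply/eq_connect0/val_inj.
case/andP=> xy yp pS; rewrite inE => /predU1P[zx|zp].
  exact/eq_connect0/val_inj.
have yS : y \in S by apply: pS; rewrite inE eqxx.
apply: connect_trans (IH y yS yp _ zp); first exact: connect1.
by move=> t tp; apply: pS; rewrite inE tp orbT.
Qed.

Hypothesis dh : distance_hereditary G.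

Lemma has_walk_distance x y q : path G x q -> last x q = y ->
  distance G x y <= size q.
Proof.
move=> xq lq; have [ltq|] := ltnP (size q) #|T|; last first.
  by apply: leq_trans; rewrite /distance -[X in _ <= X](size_iota 0) find_size.
rewrite leqNgt; apply/negP => /(before_find 0); rewrite nth_iota // add0n.
by move=> /existsP[]; exists (in_tuple q); rewrite xq lq eqxx.
Qed.

(** Distance heredity is applied to the vertex set of the path, whose ends are nonadjacent as its
    length is at least 2. A walk inside this set advances one position per edge, so it is at least
    as long as [p]. *)
Lemma chordless_geodesic x p q : chordless x p -> 1 < size p ->
  path G x q -> last x q = last x p -> size p <= size q.
Proof.
move=> cp p2 xq lq; apply: leq_trans (has_walk_distance xq lq).
pose S := [set z in x :: p].
have xS : x \in S by rewrite !inE eqxx.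
have lS : last x p \in S by rewrite inE mem_last.
have up := chordless_uniq cp.
have conn0 z (zS : z \in S) : connect (induced G S) (Sub x xS) (Sub z zS).
  apply: path_connect_induced (chordless_path cp) _ _.
    by move=> t tp; rewrite !inE tp orbT.
  by rewrite inE in zS.
have nadj : ~~ G x (last x p).
  case: p p2 cp {lq S xS lS up conn0} => [|y [|z p]] // _ /and3P[_ /allP xp _].
  by case/andP: (xp _ (mem_last _ _)).
rewrite -(dh (x := Sub x xS) (y := Sub (last x p) lS)) //; last first.
  move=> [a aS] [b bS]; apply: connect_trans (_ : connect _ _ (Sub x xS)) (conn0 b bS).
  by rewrite (sym_connect_sym (@induced_sym _ G S)); apply: conn0.
have cS : #|{: {z | z \in S}}| = (size p).+1.
  by rewrite card_sig cardsE; apply/card_uniqP.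
rewrite leqNgt; apply/negP => lt.
(* A value below [#|S| = size p + 1] is not the infinite default, so a walk attains it. *)
have : has (has_walk (induced G S) (Sub x xS) (Sub (last x p) lS)) (iota 0 (size p).+1).
  rewrite has_find size_iota -cS; apply: leq_trans lt _.
  by rewrite cS.
move=> /(nth_find 0).
rewrite -cS -/(distance _ _ _); set d := distance _ _ _ in lt *.
rewrite nth_iota ?cS ?add0n; last by apply: leq_trans lt _.
case/existsP=> w /andP[xw /eqP lw].
suff : size p <= size w by rewrite size_tuple leqNgt lt.
move/(congr1 val): lw => /= lw.
rewrite -(last_index up) -lw -[size w]add0n.
have <- : index (val (Sub x xS : {z | z \in S})) (x :: p) = 0 by rewrite /= eqxx.
(* Induction along the walk: the position of its end exceeds that of its start by at most its
   length. *)
elim: {w d lt lw}(val w) (Sub x xS : {z | _}) xw => [|b w IH] a /=.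
  by rewrite addn0.
case/andP=> ab bw; apply: leq_trans (IH b bw) _.
rewrite addnS -addSn leq_add2r; apply: chordless_index => //.
- by have : val a \in S := valP a; rewrite inE.
- by have : val b \in S := valP b; rewrite inE.
Qed.
End Geodesics.

(** * Breadth-first levels and pruning *)

(* [C] is the component of [r] in [R] and [d] the distance to [r] inside [R]. *)
Definition leveling (T : finType) (G : sgraph T) (R C : {set T}) (r : T)
    (d : T -> nat) :=
  [/\ C \subset R, r \in C,
      forall x y, x \in C -> y \in R -> G x y -> y \in C /\ d y <= (d x).+1,
      forall x, x \in C -> d x = 0 -> x = r
    & forall x k, x \in C -> d x = k.+1 -> exists y, [/\ y \in C, G x y & d y = k]].

Lemma leveling_exists (T : finType) (G : sgraph T) (R : {set T}) (r : T) :
  r \in R -> exists C d, leveling G R C r d.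
Proof.
move=> rR; pose e : rel T := [rel x y | G x y && (y \in R)].
pose W := fix W (k : nat) (x : T) {struct k} : bool :=
  if k is k'.+1 then [exists y, W k' y && e y x] else x == r.
have WS k x y : W k x -> e x y -> W k.+1 y.
  by move=> Wx xy; apply/existsP; exists x; apply/andP.
have WE x : connect e r x -> exists k, W k x.
  have walk p : forall y k, path e y p -> W k y -> exists k', W k' (last y p).
    elim: p => [|z p IH] y k /=; first by exists k.
    by case/andP=> yz zp /WS/(_ yz); apply: IH.
  by case/connectP=> p rp ->; apply: (walk p r 0 rp); apply/eqP.
have WC k x : W k x -> connect e r x.
  elim: k x => [|k IH] x /=; first by move/eqP->.
  by case/existsP=> y /andP[/IH ry yx]; apply: connect_trans ry (connect1 yx).
(* [d x] is the least length of a walk inside [R] from [r] to [x]; outside the component it is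
   unconstrained. *)
have [x|d dP] := fin_all_exists (P := fun x k =>
    connect e r x -> W k x /\ forall j, W j x -> k <= j).
  case: (boolP (connect e r x)) => [/WE Wx|_]; last by exists 0.
  by case: (ex_minnP Wx) => k Wk mink; exists k.
exists [set x | connect e r x], d; split.
- apply/subsetP => x; rewrite inE => /connectP[p rp ->].
  by case/lastP: p rp => // p y; rewrite rcons_path last_rcons => /and3P[].
- by rewrite inE.
- move=> x y; rewrite !inE => rx yR xy.
  have exy : e x y by apply/andP.
  have ry := connect_trans rx (connect1 exy); split=> //.
  by apply: (dP y ry).2; apply: WS exy; apply: (dP x rx).1.
- by move=> x; rewrite inE => /dP[+ _] => + dx; rewrite dx => /eqP.
move=> x k; rewrite inE => rx dx; have [Wx minx] := dP x rx.
move: (Wx); rewrite dx => /existsP[y /andP[Wy yx]].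
have ry := WC _ _ Wy; have [Wdy miny] := dP y ry.
exists y; rewrite inE adj_sym; case/andP: (yx) => -> _; split=> //.
apply/eqP; rewrite eqn_leq miny //= -ltnS -dx.
exact: minx (WS _ _ _ Wdy yx).
Qed.

(** * Neighbourhoods between consecutive levels *)

Section Levels.
Variables (T : finType) (G : sgraph T) (R C : {set T}) (r : T) (d : T -> nat).
Hypothesis dh : distance_hereditary G.
Hypothesis lev : leveling G R C r d.

Lemma level_adj x y : x \in C -> y \in C -> G x y ->
  d y <= (d x).+1 /\ d x <= (d y).+1.
Proof.
case: lev => /subsetP CR _ step _ _ xC yC xy; split.
  by have [] := step x y xC (CR _ yC) xy.
by have [] := step y x yC (CR _ xC); rewrite // adj_sym.
Qed.

Lemma level_far x y : x \in C -> y \in C -> (d y).+1 < d x ->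
  (y != x) && ~~ G x y.
Proof.
move=> xC yC lt; case: eqVneq lt => [->|_ lt]; first by rewrite ltnNge leqnSn.
by apply/negP => /(level_adj xC yC)[_]; rewrite leqNgt lt.
Qed.

Lemma level_neq k x y : d x = k -> d y = k.+1 -> (x != y) && (y != x).
Proof.
move=> dx dy; rewrite [y == x]eq_sym andbb; apply/eqP => xy.
by move: dy; rewrite -xy dx => /n_Sn.
Qed.

(** Follow parents down to the root; each vertex is at least two levels away from those after its
    parent, so there are no chords. *)
Lemma descent x k : x \in C -> d x = k ->
  exists p, [/\ chordless G x p, last x p = r, size p = k
              & forall z, z \in p -> z \in C /\ d z < k].
Proof.
case: lev => _ _ _ zero down; elim: k x => [|k IH] x xC dx.
  by exists [::]; split=> //=; apply: zero.
have [y [yC xy dy]] := down _ _ xC dx.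
have [p [cp lp sp lowp]] := IH y yC dy.
exists (y :: p); split=> //=; last 1 first.
- by move=> z /predU1P[->|/lowp[zC /ltnW]]; rewrite ?dy.
- rewrite xy cp andbT; apply/allP => z /lowp[zC lt].
  by apply: level_far => //; rewrite dx !ltnS.
by rewrite sp.
Qed.

Lemma chordless_descent x p : x \in C -> chordless G x p -> 1 < size p ->
  last x p = r -> size p <= d x.
Proof.
move=> xC cp p2 lp; have [q [cq lq <- _]] := descent xC (erefl _).
by apply: (chordless_geodesic dh cp p2 (chordless_path cq)); rewrite lp.
Qed.

(* Otherwise y, x, z and a shortest path from z to r form an induced path from y
   to r which is longer than d y. *)
Lemma down_adj k x y z : x \in C -> y \in C -> z \in C ->
  d x = k.+1 -> d y = k.+1 -> d z = k -> G x y -> G x z -> G y z.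
Proof.
move=> xC yC zC dx dy dz xy xz; apply/negPn/negP => yz.
have [p [cp lp sp lowp]] := descent zC dz.
have : size [:: x, z & p] <= d y.
  apply: chordless_descent => //=; rewrite [G y x]adj_sym xy xz cp !andbT /=.
  have /andP[-> _] := level_neq dz dy; rewrite yz /=.
  by apply/andP; split; apply/allP => t /lowp[tC lt]; apply: level_far => //;
    rewrite ?dx ?dy !ltnS.
by rewrite /= sp dy ltnn.
Qed.

(** By [down_adj], [x] and [y] may be taken nonadjacent. If [y] misses [z], then [y, v, x, z] and a
    descent from [z] form an induced path to [r] of length [k + 3], against [d y = k + 1]. *)
Lemma down_share k v x y z : v \in C -> x \in C -> y \in C -> z \in C ->
  d v = k.+2 -> d x = k.+1 -> d y = k.+1 -> d z = k ->
  G v x -> G v y -> G x z -> G y z.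
Proof.
move=> vC xC yC zC dv dx dy dz vx vy xz; apply/negPn/negP => yz.
have [p [cp lp sp lowp]] := descent zC dz.
have xy : ~~ G x y by apply: contraNN yz => xy; exact: (down_adj xC yC zC dx dy dz xy xz).
have : size [:: v, x, z & p] <= d y.
  apply: chordless_descent => //=.
  rewrite [G y v]adj_sym vy vx xz cp !andbT [G y x]adj_sym xy yz.
  have /andP[-> ->] : (z != v) && ~~ G v z.
    by apply: level_far => //; rewrite dv dz.
  have /andP[-> _] := level_neq dz dy.
  rewrite (contraNneq _ yz) => [/=|<- //].
  by apply/and3P; split; apply/allP => t /lowp[tC lt]; apply: level_far => //;
    rewrite ?dx ?dy ?dv !ltnS // ltnW.
by rewrite /= sp dy ltnNge leqnSn.
Qed.

(** A parent [z] of [u] is a parent of [x] by [down_adj] and of [y] by [down_share]. If [u] misses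
    [y], the induced path [v, y, z, u] is longer than [v, x, u]. *)
Lemma down_side k v x y u :
  [&& v \in C, x \in C, y \in C & u \in C] -> d v = k.+2 ->
  d x = k.+1 -> d y = k.+1 -> d u = k.+1 ->
  G v x -> G v y -> ~~ G v u -> G u x -> G u y.
Proof.
move=> /and4P[vC xC yC uC] dv dx dy du vx vy vu ux; apply/negPn/negP => uy.
case: lev => _ _ _ _ down; have [z [zC uz dz]] := down _ _ uC du.
have xz : G x z by exact: (down_adj uC xC zC du dx dz ux uz).
have yz : G y z by exact: (down_share vC xC yC zC dv dx dy dz vx vy xz).
suff : 3 <= 2 by [].
apply: (@chordless_geodesic _ _ dh v [:: y; z; u] [:: x; u]) => //=; last first.
  by rewrite vx adj_sym ux.
rewrite vy yz [G z u]adj_sym uz vu [G y u]adj_sym uy.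
have /andP[-> ->] : (z != v) && ~~ G v z by apply: level_far => //; rewrite dv dz.
have /andP[-> _] := level_neq du dv.
by rewrite (contraNneq _ vu) // => ->.
Qed.

(** Upper neighbourhoods that meet are nested. If [y] is private to [v] and [z] to [w], a parent [t]
    of [y] is also one of [x] and [z]; then [v, y, z, w] or [v, y, t, z, w] is an induced path
    longer than [v, x, w]. *)
Lemma down_laminar k v w x y z : v \in C -> w \in C ->
  [&& x \in C, y \in C & z \in C] -> d v = k.+2 -> d w = k.+2 ->
  d x = k.+1 -> d y = k.+1 -> d z = k.+1 -> G v x -> G w x ->
  G v y -> ~~ G w y -> G w z -> G v z.
Proof.
move=> vC wC /and3P[xC yC zC] dv dw dx dy dz vx wx vy wy wz.
apply/negPn/negP => vz.
have vw : ~~ G v w by apply: contraNN wy => vw; exact: (down_adj vC wC yC dv dw dy vw vy).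
case: lev => _ _ _ _ down; have [t [tC yt dt]] := down _ _ yC dy.
have xt : G x t by exact: (down_share vC yC xC tC dv dy dx dt vy vx yt).
have zt : G z t by exact: (down_share wC xC zC tC dw dx dz dt wx wz xt).
have wv : w != v by apply: contraNneq wy => ->.
have /andP[tv vt] : (t != v) && ~~ G v t.
  by apply: level_far => //; rewrite dv dt.
have /andP[tw wt] : (t != w) && ~~ G w t.
  by apply: level_far => //; rewrite dw dt.
have /andP[zv _] := level_neq dz dv.
have /andP[_ yw] := level_neq dy dw.
have zy : z != y by apply: contraNneq wy => <-.
have vxw : path G v [:: x; w] by rewrite /= vx adj_sym wx.
have [yz|yz] := boolP (G y z).
  suff : 3 <= 2 by [].
  apply: (@chordless_geodesic _ _ dh v [:: y; z; w] [:: x; w]) => //=.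
  by rewrite vy yz [G z w]adj_sym wz zv vz wv vw yw [G y w]adj_sym wy.
suff : 4 <= 2 by [].
apply: (@chordless_geodesic _ _ dh v [:: y; t; z; w] [:: x; w]) => //=.
rewrite vy yt [G t z]adj_sym zt [G z w]adj_sym wz tv vt zv vz wv vw zy yz yw.
by rewrite [G y w]adj_sym wy [w == t]eq_sym tw [G t w]adj_sym wt.
Qed.

(** An induced path of length 3 inside [M] would have a shortcut of length 2 through [c]. *)
Lemma dominated_p4_free c (M : {set T}) :
  (forall x, x \in M -> G c x) -> p4_free G M.
Proof.
move=> cM a b b' a' /and4P[aM bM b'M a'M] uq ab bb' b'a' ab' ba'.
apply/negPn/negP => aa'; suff : 3 <= 2 by [].
apply: (@chordless_geodesic _ _ dh a [:: b; b'; a'] [:: c; a']) => //=.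
  move: uq; rewrite /= !inE !negb_or => /and4P[/and3P[_ n1 n2] /andP[_ n3] _ _].
  by rewrite ab bb' b'a' ab' ba' aa' [b' == a]eq_sym n1 [a' == a]eq_sym n2 [a' == b]eq_sym n3.
by rewrite (cM a') // adj_sym cM.
Qed.

End Levels.

(** * Existence of a vertex to prune *)

Section Pruning.
Variables (T : finType) (G : sgraph T).

(** Covers an isolated [v] as well as one pendant at [u]. *)
Definition leaf (R : {set T}) u v := [forall x in R, (x != u) ==> ~~ G v x].

Definition prunable (R : {set T}) u v :=
  [&& u \in R, v \in R, u != v & twins G R u v || leaf R u v].

Hypothesis dh : distance_hereditary G.

Lemma twins_module (R M : {set T}) u v : M \subset R ->
  (forall a b t, a \in M -> b \in M -> t \in R -> t \notin M -> G a t -> G b t) ->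
  u \in M -> v \in M -> u != v -> twins G M u v -> prunable R u v.
Proof.
move=> /subsetP MR mod uM vM uv /twinsP tw; rewrite /prunable !MR // uv /=.
apply/orP; left; apply/twinsP => x xR xu xv.
have [xM|xM] := boolP (x \in M); first exact: tw.
by apply/idP/idP; apply: mod.
Qed.

Lemma prunable_exists (R : {set T}) : 1 < #|R| -> exists u v, prunable R u v.
Proof.
move=> R2; have /card_gt0P[r rR] : 0 < #|R| by apply: ltnW.
have [C [d lev]] := leveling_exists G rR.
have [/subsetP CR rC step zero down] := lev.
case: (arg_maxnP d rC) => m mC maxm; case dm: (d m) => [|k].
  (* Only level 0 is occupied, so [r] is isolated in [R] and any other [u] serves. *)
  have [u uR ur] : exists2 u, u \in R & u != r.
    have := cardsD1 r R; rewrite rR add1n => cR.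
    have /card_gt0P[u] : 0 < #|R :\ r| by rewrite cR in R2.
    by rewrite !inE => /andP[]; exists u.
  exists u, r; rewrite /prunable uR rR ur; apply/orP; right.
  apply/forall_inP => x xR; apply/implyP => xu; apply/negP => rx.
  have [xC _] := step _ _ rC xR rx.
  have x0 : d x = 0 by apply/eqP; rewrite -leqn0 -dm; apply: maxm.
  by move: rx; rewrite (zero x) // adj_irr.
pose Nd x := [set y in C | (d y == k) && G x y].
pose L := [set x in C | d x == k.+1].
have mL : m \in L by rewrite inE dm eqxx andbT.
have NdP x y : reflect [/\ y \in C, d y = k & G x y] (y \in Nd x).
  by rewrite inE; apply: (iffP and3P) => [[? /eqP]|[? -> ?]].
have LP x : reflect (x \in C /\ d x = k.+1) (x \in L).
  by rewrite inE; apply: (iffP andP) => [[? /eqP]|[? ->]].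
have Ladj x y : x \in L -> y \in R -> G x y -> y \in L \/ y \in Nd x.
  case/LP => xC dx yR xy; have [yC _] := step _ _ xC yR xy.
  have yle : d y <= k.+1 by rewrite -dm; apply: maxm.
  have [_ kle] := level_adj lev xC yC xy; rewrite dx ltnS in kle.
  have [ky|ky] := eqVneq (d y) k; first by right; apply/NdP.
  by left; apply/LP; split=> //; apply/eqP; rewrite eqn_leq yle ltn_neqAle eq_sym ky.
have NdL x y : x \in L -> y \in L -> G x y -> Nd x = Nd y.
  case/LP=> xC dx /LP[yC dy] xy; apply/setP => z.
  apply/NdP/NdP => -[zC dz zz]; split=> //.
    exact: (down_adj dh lev xC yC zC dx dy dz xy).
  by apply: (down_adj dh lev yC xC zC dy dx dz _ zz); rewrite adj_sym.
have [/existsP[x /existsP[y /and4P[xL yL xy /eqP Nxy]]]|noNd] :=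
    boolP [exists x, exists y, [&& x \in L, y \in L, x != y & Nd x == Nd y]].
  (* A class of equal upper neighbourhoods: any common parent [c] dominates it, and by [NdL] no edge
     inside the last level leaves it. *)
  pose M := [set z in L | Nd z == Nd x].
  have MR : M \subset R by apply/subsetP => z; rewrite inE => /andP[/LP[/CR]].
  have /LP[xC dx] := xL; have [c [cC xc dc]] := down _ _ xC dx.
  have free : p4_free G M.
    apply: (@dominated_p4_free _ G dh c) => // z; rewrite inE => /andP[_ /eqP Nz].
    have : c \in Nd z by rewrite Nz; apply/NdP.
    by case/NdP; rewrite adj_sym.
  have M2 : 1 < #|M|.
    apply/card_gt1P; exists x, y; split=> //; first by rewrite inE xL eqxx.
    by rewrite inE yL Nxy eqxx.
  have [u [v [uM vM uv tw]]] := p4_free_twins (@adj_sym _ G) free M2.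
  exists u, v; apply: twins_module MR _ uM vM uv tw => a b t.
  have MP z : (z \in M) = (z \in L) && (Nd z == Nd x) by rewrite inE.
  rewrite !MP => /andP[aL /eqP Na] /andP[bL /eqP Nb] tR tM at_.
  case: (Ladj _ _ aL tR at_) => [tL|].
    by move: tM; rewrite tL -(NdL a t) // Na eqxx.
  by rewrite Na -Nb => /NdP[].
(* From here on distinct vertices of the last level have distinct upper neighbourhoods, so by [NdL]
   this level is edgeless. *)
have Ndinj x y : x \in L -> y \in L -> Nd x = Nd y -> x = y.
  move=> xL yL Nxy; apply/eqP/negPn/negP => xy.
  by case/existsP: noNd; exists x; apply/existsP; exists y; rewrite xL yL xy Nxy eqxx.
case: (arg_minnP (fun x => #|Nd x|) mL) => x xL minx.
have xN t : t \in R -> G x t -> t \in Nd x.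
  move=> tR xt; case: (Ladj _ _ xL tR xt) => // tL.
  have Nxt := NdL _ _ xL tL xt.
  by move: xt; rewrite (Ndinj _ _ xL tL Nxt) adj_irr.
have /LP[xC dx] := xL.
have [N2|N1] := ltnP 1 #|Nd x|; last first.
  have [u [uC xu du]] := down _ _ xC dx; have uN : u \in Nd x by apply/NdP.
  exists u, x; rewrite /prunable !CR //= andbC (contraTneq _ xu) => [|->]; last first.
    by rewrite adj_irr.
  rewrite andbT; apply/orP; right; apply/forall_inP => t tR; apply/implyP.
  apply: contraNN => /(xN t tR) tN; apply/eqP.
  exact: (card_le1_eqP N1).
have NR : Nd x \subset R by apply/subsetP => z /NdP[/CR].
have free : p4_free G (Nd x) by apply: (@dominated_p4_free _ G dh x) => // z /NdP[].
have [u [v [uN vN uv tw]]] := p4_free_twins (@adj_sym _ G) free N2.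
(* Level 0 contains only [r], but [Nd x] has two elements. *)
have k0 : k != 0.
  apply: contraNneq uv => k0; have [uC du _] := NdP _ _ uN; have [vC dv _] := NdP _ _ vN.
  by rewrite (zero u) ?du // (zero v) ?dv.
exists u, v; apply: twins_module NR _ uN vN uv tw => a b t aN bN tR tN at_.
have [aC da xa] := NdP _ _ aN; have [bC db xb] := NdP _ _ bN.
have [tC _] := step _ _ aC tR at_.
have xt : ~~ G x t by apply: contraNN tN; apply: xN.
have [j kE] : exists j, k = j.+1 by case: (k) k0 => // j _; exists j.
rewrite kE in dm dx da db.
have := level_adj lev aC tC at_; rewrite da => -[ub lb].
(* The neighbour [t] of [a] lies one level above [a], beside it, or in the last level; these cases
   use [down_share], [down_side] and [down_laminar]. *)
have [dt|dt] := eqVneq (d t) j; first exact: (down_share dh lev xC aC bC tC dx).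
have [dt1|dt1] := eqVneq (d t) j.+1.
  rewrite adj_sym; apply: (down_side dh lev _ dx da db dt1 xa xb xt).
    by rewrite xC aC bC tC.
  by rewrite adj_sym.
have dt2 : d t = j.+2.
  have tm : d t <= j.+2 by rewrite -dm; apply: maxm.
  apply/eqP; rewrite eqn_leq tm /=.
  by rewrite ltn_neqAle eq_sym dt1 ltn_neqAle eq_sym dt -ltnS.
have tL : t \in L by apply/LP; rewrite kE.
apply/negPn/negP => bt.
(* As [b] is in [Nd x] but not in [Nd t], minimality of [Nd x] forbids [Nd t] to be contained in it.
   Then [b] and [z] are private neighbours of [x] and [t], which share [a], against laminarity. *)
have [z zNt zNx] : exists2 z, z \in Nd t & z \notin Nd x.
  apply/subsetPn/negP => sub; have := minx t tL; rewrite leqNgt.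
  rewrite proper_card // properE sub; apply/subsetPn; exists b => //.
  by apply: contraNN bt => /NdP[]; rewrite adj_sym.
case/NdP: zNt => zC; rewrite kE => dz tz.
case/negP: zNx; apply/NdP; split=> //; first by rewrite kE.
apply: (down_laminar dh lev xC tC _ dx dt2 da db dz xa _ xb) => //.
- by rewrite aC bC zC.
- by rewrite adj_sym.
- by rewrite adj_sym.
Qed.

End Pruning.

(** * Merging blocks *)

Lemma disjointsU (T : finType) (A B C : {set T}) :
  [disjoint A :|: B & C] = [disjoint A & C] && [disjoint B & C].
Proof. by rewrite -!setI_eq0 setIUl setU_eq0. Qed.

Lemma disjointUs (T : finType) (A B C : {set T}) :
  [disjoint C & A :|: B] = [disjoint C & A] && [disjoint C & B].
Proof. by rewrite -!setI_eq0 setIUr setU_eq0. Qed.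

Section Blocks.
Variables (T : finType) (G : sgraph T).
Implicit Types (R A B W X Y : {set T}) (H S : T -> {set T}) (c : bool * bool).

Definition blocks R H S :=
  [/\ forall u, u \in R -> u \in H u /\ S u \subset H u,
      forall x, exists2 u, u \in R & x \in H u,
      forall u v, u \in R -> v \in R -> u != v -> [disjoint H u & H v]
    & forall u v x y, u \in R -> v \in R -> u != v -> x \in H u -> y \in H v ->
        G x y = [&& x \in S u, y \in S v & G u v]].

(* The flags of [c] tell whether black and white occur in [X]. *)
Definition feasible A X c (b w : nat) := exists B W,
  [/\ [/\ B \subset A, W \subset A, [disjoint B & W]
        & forall x y, x \in B -> y \in W -> ~~ G x y],
      #|B| = b, #|W| = w, (B :&: X != set0) = c.1 & (W :&: X != set0) = c.2].

Lemma feasible_card A X c b w : feasible A X c b w -> b <= #|A| /\ w <= #|A|.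
Proof.
by case=> B [W [[BA WA _ _] <- <- _ _]]; rewrite !subset_leq_card.
Qed.

Lemma blocks_singletons : blocks setT set1 set1.
Proof.
split=> [u _|x|u v _ _ uv|u v x y _ _ _ /set1P-> /set1P->].
- by rewrite inE eqxx.
- by exists x; rewrite ?inE.
- by rewrite disjoints1 inE.
- by rewrite !inE !eqxx.
Qed.

Lemma feasible_singleton u c b w : feasible [set u] [set u] c b w <->
  (c, b, w) \in [:: (false, false, 0, 0); (true, false, 1, 0); (false, true, 0, 1)].
Proof.
have n0 : [set u] != set0 by apply/set0Pn; exists u; rewrite inE.
split=> [[B [W [[Bu Wu BW _] <- <-]]]|]; last first.
  rewrite !inE => /or3P[] /eqP[-> -> ->].
  - exists set0, set0; rewrite !set0I !cards0 eqxx; split=> //; split; rewrite ?sub0set //.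
      by rewrite disjoints_subset sub0set.
    by move=> x y; rewrite inE.
  - exists [set u], set0; rewrite set0I setIid cards0 cards1 eqxx n0; split=> //.
    split; rewrite ?sub0set ?subxx //; first by rewrite disjoint_sym disjoints_subset sub0set.
    by move=> x y _; rewrite inE.
  exists set0, [set u]; rewrite set0I setIid cards0 cards1 eqxx n0; split=> //.
  split; rewrite ?sub0set ?subxx //; first by rewrite disjoints_subset sub0set.
  by move=> x y; rewrite !inE.
case: c => c1 c2 /= <- <-; rewrite !inE.
move: Bu Wu BW; rewrite !subset1 => /orP[] /eqP-> /orP[] /eqP->;
  rewrite ?set0I ?setIid ?cards0 ?cards1 ?eqxx ?(negbTE n0) //.
by rewrite disjoints1 inE eqxx.
Qed.

Section Merge.
Variables (R : {set T}) (H S : T -> {set T}) (u v : T).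
Hypotheses (ok : blocks R H S) (uvP : prunable G R u v).

Definition merged_block x := if x == u then H u :|: H v else H x.
(** Twins see the other blocks alike, so both sets stay attached. A leaf [v] sees no block but that
    of [u], so after merging only [S u] is attached to the outside. *)
Definition merged_twins x :=
  if x == u then if twins G R u v then S u :|: S v else S u else S x.

Lemma blocks_merge : blocks (R :\ v) merged_block merged_twins.
Proof.
have [inH cover disj adjE] := ok; have /and4P[uR vR uv pr] := uvP.
have SuH : S u \subset H u by case: (inH u uR).
have SvH : S v \subset H v by case: (inH v vR).
have Hv x : x \in H v -> x \notin H u.
  by move=> xv; apply/negP => xu; have /disjointFr/(_ xu) := disj u v uR vR uv; rewrite xv.
have key x w y : w \in R -> w != v -> w != u ->
    x \in H u :|: H v -> y \in H w ->
    G x y = [&& x \in merged_twins u, y \in S w & G u w].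
  move=> wR wv wu; rewrite inE /merged_twins eqxx => xH yw.
  have [xu|xu] := boolP (x \in H u).
    have xv : x \in S v = false.
      by apply: contraTF xu => /(subsetP SvH)/Hv.
    rewrite (adjE u w) // 1?eq_sym //; congr andb.
    by case: ifP; rewrite ?inE ?xv ?orbF.
  rewrite (negbTE xu) /= in xH; rewrite (adjE v w) // 1?eq_sym //.
  have xu' : x \in S u = false by apply: contraNF xu; apply: (subsetP SuH).
  case: ifP pr => [/twinsP tw _|_ /= /forall_inP lf].
    by rewrite inE xu' /= (tw w).
  by rewrite xu' /= (negbTE (implyP (lf w wR) wu)) !andbF.
split.
- move=> x; rewrite inE => /andP[xv xR]; rewrite /merged_block /merged_twins.
  case: eqP => [->|_]; last exact: inH.
  rewrite inE (inH u uR).1; split=> //.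
  by case: ifP => _; [apply: setUSS | apply: subset_trans SuH (subsetUl _ _)].
- move=> x; have [w wR xw] := cover x.
  have [wv|wv] := eqVneq w v.
    by exists u; rewrite ?inE ?uv // /merged_block eqxx inE -wv xw orbT.
  exists w; rewrite ?inE ?wv //; rewrite /merged_block.
  by case: eqP => // <-; rewrite inE xw.
- have dU w : w \in R -> w != v -> w != u -> [disjoint H u :|: H v & H w].
    by move=> wR wv wu; rewrite disjointsU; apply/andP; split; apply: disj; rewrite // eq_sym.
  move=> x y; rewrite !inE => /andP[xv xR] /andP[yv yR] xy; rewrite /merged_block.
  case: (eqVneq x u) => [xE|xu]; case: (eqVneq y u) => [yE|yu].
  + by rewrite xE yE eqxx in xy.
  + exact: dU.
  + by rewrite disjoint_sym; apply: dU.
  + exact: disj.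
move=> a b x y; rewrite !inE => /andP[av aR] /andP[bv bR] ab.
rewrite /merged_block; case: (eqVneq a u) => [aE|au]; case: (eqVneq b u) => [bE|bu].
- by rewrite aE bE eqxx in ab.
- by move=> xH yH; rewrite aE (key _ b) // /merged_twins (negbTE bu).
- move=> xH yH; rewrite bE adj_sym (key _ a) // [merged_twins a]/merged_twins (negbTE au).
  by rewrite andbCA adj_sym.
by move=> xH yH; rewrite (adjE a b) // /merged_twins (negbTE au) (negbTE bu).
Qed.

Definition compatible c1 c2 := ~~ (c1.1 && c2.2) && ~~ (c1.2 && c2.1).

Definition join_flags (tw : bool) c1 c2 :=
  if tw then (c1.1 || c2.1, c1.2 || c2.2) else c1.

(** A coloring of the union restricts to both blocks. Conversely, edges between the blocks join
    exactly [S u] to [S v], and only if [G u v], so whether two colorings fit together depends on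
    their flags alone. *)
Lemma feasible_merge c b w :
  feasible (merged_block u) (merged_twins u) c b w <->
  exists c1 c2 b1 w1 b2 w2,
  [/\ feasible (H u) (S u) c1 b1 w1, feasible (H v) (S v) c2 b2 w2,
      b = b1 + b2 /\ w = w1 + w2, G u v -> compatible c1 c2
    & c = join_flags (twins G R u v) c1 c2].
Proof.
have [inH cover disj adjE] := ok; have /and4P[uR vR uv pr] := uvP.
have SuH : S u \subset H u by case: (inH u uR).
have SvH : S v \subset H v by case: (inH v vR).
have dUV := disj u v uR vR uv.
rewrite /merged_block /merged_twins eqxx.
set X := if _ then _ else _.
have cardE B : B \subset H u :|: H v -> #|B| = #|B :&: H u| + #|B :&: H v|.
  move=> BH; rewrite -cardsUI -setIUr (setIidPl BH).
  rewrite setIACA setIid; move: dUV; rewrite -setI_eq0 => /eqP->.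
  by rewrite setI0 cards0 addn0.
have flagE B : (B :&: X != set0) = if twins G R u v
    then (B :&: H u :&: S u != set0) || (B :&: H v :&: S v != set0)
    else B :&: H u :&: S u != set0.
  rewrite -!setIA (setIidPr SuH) (setIidPr SvH) /X.
  by case: ifP => // _; rewrite setIUr setU_eq0 negb_and.
split.
  case=> B [W [[BH WH BW nadj] <- <- cB cW]].
  exists (B :&: H u :&: S u != set0, W :&: H u :&: S u != set0).
  exists (B :&: H v :&: S v != set0, W :&: H v :&: S v != set0).
  exists #|B :&: H u|, #|W :&: H u|, #|B :&: H v|, #|W :&: H v|.
  have feas Y Z : feasible Y Z (B :&: Y :&: Z != set0, W :&: Y :&: Z != set0)
      #|B :&: Y| #|W :&: Y|.
    exists (B :&: Y), (W :&: Y); split=> //; split; rewrite ?subsetIr //.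
      by apply: disjointWl (subsetIl _ _) (disjointWr (subsetIl _ _) BW).
    by move=> x y /setIP[xB _] /setIP[yW _]; apply: nadj.
  split=> //.
  - by rewrite -!cardE.
  - move=> Guv; rewrite /compatible /=; apply/andP; split; apply/negP => /andP[].
      move=> /set0Pn[x /setIP[/setIP[xB xH] xS]] /set0Pn[y /setIP[/setIP[yW yH] yS]].
      by have := nadj x y xB yW; rewrite (adjE u v) // xS yS Guv.
    move=> /set0Pn[x /setIP[/setIP[xB xH] xS]] /set0Pn[y /setIP[/setIP[yW yH] yS]].
    by have := nadj y x yW xB; rewrite adj_sym (adjE u v) // xS yS Guv.
  by case: c cB cW => c1 c2 /= <- <-; rewrite !flagE /join_flags; case: ifP.
case=> c1 [c2 [b1 [w1 [b2 [w2 [f1 f2 [-> ->] comp ->]]]]]].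
case: f1 => B1 [W1 [[B1H W1H BW1 nadj1] <- <- cB1 cW1]].
case: f2 => B2 [W2 [[B2H W2H BW2 nadj2] <- <- cB2 cW2]].
have HuI A1 A2 : A1 \subset H u -> A2 \subset H v -> (A1 :|: A2) :&: H u = A1.
  move=> A1H A2H; rewrite setIUl (setIidPl A1H).
  have /disjoint_setI0-> : [disjoint A2 & H u] by rewrite disjoint_sym (disjointWr A2H).
  by rewrite setU0.
have HvI A1 A2 : A1 \subset H u -> A2 \subset H v -> (A1 :|: A2) :&: H v = A2.
  move=> A1H A2H; rewrite setIUl (setIidPl A2H).
  have /disjoint_setI0-> : [disjoint A1 & H v] by rewrite (disjointWl A1H).
  by rewrite set0U.
exists (B1 :|: B2), (W1 :|: W2); split.
- split; try exact: setUSS.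
    rewrite disjointsU !disjointUs BW1 BW2 andbT /=; apply/andP; split.
      exact: disjointWl B1H (disjointWr W2H dUV).
    rewrite disjoint_sym; exact: disjointWl W1H (disjointWr B2H dUV).
  move=> x y /setUP[xB|xB] /setUP[yW|yW].
  + exact: nadj1.
  + rewrite (adjE u v) ?(subsetP B1H) ?(subsetP W2H) //.
    apply/negP => /and3P[xS yS /comp/andP[/negP[]]].
    rewrite -cB1 -cW2; apply/andP; split; apply/set0Pn;
      by [exists x; rewrite inE xB | exists y; rewrite inE yW].
  + rewrite adj_sym (adjE u v) ?(subsetP B2H) ?(subsetP W1H) //.
    apply/negP => /and3P[yS xS /comp/andP[_ /negP[]]].
    rewrite -cW1 -cB2; apply/andP; split; apply/set0Pn;
      by [exists x; rewrite inE xB | exists y; rewrite inE yW].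
  + exact: nadj2.
- by rewrite cardE ?setUSS // HuI // HvI.
- by rewrite cardE ?setUSS // HuI // HvI.
- by rewrite flagE HuI // HvI // cB1 cB2 /join_flags; case: ifP.
- by rewrite flagE HuI // HvI // cW1 cW2 /join_flags; case: ifP.
Qed.

(** Both blocks are nonempty, so each summand lies in the range [0, ..., n - 1] of a loop, while the
    sums fit into a table. *)
Lemma feasible_merge_bound c1 c2 b1 w1 b2 w2 :
  feasible (H u) (S u) c1 b1 w1 -> feasible (H v) (S v) c2 b2 w2 ->
  [/\ b1 < #|T|, w1 < #|T|, b2 < #|T| & w2 < #|T|]
  /\ b1 + b2 <= #|T| /\ w1 + w2 <= #|T|.
Proof.
have [inH _ disj _] := ok; have /and4P[uR vR uv _] := uvP.
move=> /feasible_card[b1H w1H] /feasible_card[b2H w2H].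
have Hu0 : 0 < #|H u| by apply/card_gt0P; exists u; case: (inH u uR).
have Hv0 : 0 < #|H v| by apply/card_gt0P; exists v; case: (inH v vR).
have HT : #|H u| + #|H v| <= #|T|.
  have := max_card [in H u :|: H v].
  by rewrite cardsU (disjoint_setI0 (disj _ _ _ _ uv)) // cards0 subn0.
have lt1 : #|H u| < #|T| by apply: leq_trans HT; rewrite -addn1 leq_add2l.
have lt2 : #|H v| < #|T| by apply: leq_trans HT; rewrite -add1n leq_add2r.
by split; [split; apply: leq_ltn_trans; eauto
         | split; apply: leq_trans HT; apply: leq_add].
Qed.

End Merge.

Lemma feasible_last R H S u b w : blocks R H S -> R = [set u] ->
  (exists c, feasible (H u) (S u) c b w) <->
  exists B W, bw_coloring G (Posz b) (Posz w) B W.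
Proof.
case=> _ cover _ _ RE; have HE : H u = setT.
  by apply/setP => x; have [v] := cover x; rewrite RE !inE => /eqP->.
rewrite HE; split.
  by case=> c [B [W [[_ _ BW nadj] <- <- _ _]]]; exists B, W.
case=> B [W [BW [<-] [<-] nadj]].
by eexists (_, _), B, W; split=> //; split; rewrite ?subsetT.
Qed.

End Blocks.

(** * Programs with bounded loops *)

(* [PFor r p] runs [p] with register [r] equal to 0, 1, ..., n - 1, where n is the
   content of register 0; this makes running times readable off the syntax. *)
Inductive prog :=
  | PSkip
  | PAssign of nat & expr
  | PWrite of nat & expr & expr
  | PSeq of prog & prog
  | PIf of expr & prog & prog
  | PFor of nat & prog.

Definition succ_reg r := Add (Reg r) (Const 1).

(** [Leq] is the only comparison, so r < n is tested as r + 1 <= n. *)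
Fixpoint compile (p : prog) : cmd :=
  match p with
  | PSkip => Skip
  | PAssign r e => Assign r e
  | PWrite a e1 e2 => Write a e1 e2
  | PSeq p1 p2 => Seq (compile p1) (compile p2)
  | PIf e p1 p2 => If e (compile p1) (compile p2)
  | PFor r p1 => Seq (Assign r (Const 0))
      (While (Leq (succ_reg r) (Reg 0)) (Seq (compile p1) (Assign r (succ_reg r))))
  end.

(** A total semantics: the loop bound is read at entry and the counter is forced to its next value.
    This matches [compile] when bodies change neither their counter nor register 0. *)
Fixpoint denote (p : prog) (s : state) : state :=
  match p with
  | PSkip => s
  | PAssign r e => set_reg s r (eval s e)
  | PWrite a e1 e2 => set_arr s a (eval s e1) (eval s e2)
  | PSeq p1 p2 => denote p2 (denote p1 s)
  | PIf e p1 p2 => if eval s e != 0%R then denote p1 s else denote p2 s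
  | PFor r p1 => iteri `|reg s 0|%N
      (fun k s' => set_reg (denote p1 s') r (Posz k.+1)) (set_reg s r 0%R)
  end.

Fixpoint mods (r : nat) (p : prog) : bool :=
  match p with
  | PSkip | PWrite _ _ _ => false
  | PAssign r' _ => r == r'
  | PSeq p1 p2 | PIf _ p1 p2 => mods r p1 || mods r p2
  | PFor r' p1 => (r == r') || mods r p1
  end.

Fixpoint writes (a : nat) (p : prog) : bool :=
  match p with
  | PSkip | PAssign _ _ => false
  | PWrite a' _ _ => a == a'
  | PSeq p1 p2 | PIf _ p1 p2 => writes a p1 || writes a p2
  | PFor _ p1 => writes a p1
  end.

Fixpoint wf (p : prog) : bool :=
  match p with
  | PSkip | PAssign _ _ | PWrite _ _ _ => true
  | PSeq p1 p2 | PIf _ p1 p2 => wf p1 && wf p2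
  | PFor r p1 => ~~ mods r p1 && wf p1
  end.

(** In a loop, a round adds 6 for the test and 4 for the increment; the initial assignment costs 2
    and the failing test 6. For a conditional, the sum bounds both branches. *)
Fixpoint time (p : prog) : {poly nat} :=
  match p with
  | PSkip => 1%:P%R
  | PAssign _ e => ((cost e).+1)%:P%R
  | PWrite _ e1 e2 => ((cost e1 + cost e2).+1)%:P%R
  | PSeq p1 p2 => (time p1 + time p2)%R
  | PIf e p1 p2 => (time p1 + time p2 + ((cost e).+1)%:P)%R
  | PFor _ p1 => ('X * (time p1 + 10%:P) + 8%:P)%R
  end.

Definition frame (p : prog) (s s' : state) :=
  (forall r, ~~ mods r p -> reg s' r = reg s r) /\
  (forall a k, ~~ writes a p -> arr s' a k = arr s a k).

Lemma frame_trans p s1 s2 s3 : frame p s1 s2 -> frame p s2 s3 -> frame p s1 s3.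
Proof.
move=> [r12 a12] [r23 a23]; split=> [r rp|a k ap]; first by rewrite r23 ?r12.
by rewrite a23 ?a12.
Qed.

Lemma frame_weaken p q s s' : (forall r, mods r p -> mods r q) ->
  (forall a, writes a p -> writes a q) -> frame p s s' -> frame q s s'.
Proof.
by move=> mpq wpq [rs as_]; split=> [r|a k] nq; [apply: rs | apply: as_];
  apply: contraNN nq; auto.
Qed.

Lemma frame_denote p s : frame p s (denote p s).
Proof.
elim: p s => /= [|r e|a e1 e2|p1 IH1 p2 IH2|e p1 IH1 p2 IH2|r p IH] s //.
- by split=> //= r' /negbTE ->.
- by split=> //= a' k /negbTE ->.
- apply: frame_trans; [apply: frame_weaken (IH1 _) | apply: frame_weaken (IH2 _)];
    by move=> x /= ->; rewrite ?orbT.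
- by case: ifP => _; [apply: frame_weaken (IH1 _) | apply: frame_weaken (IH2 _)];
    move=> x /= ->; rewrite ?orbT.
have set_frame s' v : frame (PFor r p) s' (set_reg s' r v).
  by split=> // r'; rewrite /= negb_or => /andP[/negbTE ->].
elim: `|_| => [|k IHk] //=.
apply: frame_trans IHk (frame_trans _ (set_frame _ _)).
by apply: frame_weaken (IH _) => x /= ->; rewrite ?orbT.
Qed.

(** Invariant rule. The step also receives the counter value and the frame relative to the entry
    state, so [I] need only describe what the loop changes. *)
Lemma denote_for (I : nat -> state -> Prop) r p s n :
  reg s 0 = Posz n -> I 0 (set_reg s r 0%R) ->
  (forall k s', k < n -> reg s' r = Posz k -> frame (PFor r p) s s' ->
     I k s' -> I k.+1 (set_reg (denote p s') r (Posz k.+1))) ->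
  I n (denote (PFor r p) s).
Proof.
move=> /= -> I0 Istep /=.
have set_frame s' v : frame (PFor r p) s' (set_reg s' r v).
  by split=> // r'; rewrite /= negb_or => /andP[/negbTE ->].
have [//] : I n (iteri n (fun k s' => set_reg (denote p s') r (Posz k.+1)) (set_reg s r 0%R))
  /\ True.
suff loop m : m <= n -> let s' := iteri m
    (fun k s' => set_reg (denote p s') r (Posz k.+1)) (set_reg s r 0%R) in
    [/\ I m s', reg s' r = Posz m & frame (PFor r p) s s'].
  by split=> //; case: (loop n (leqnn n)).
elim: m => [_|m IH ltm] /=; first by rewrite eqxx.
have [Im rm fm] := IH (ltnW ltm); split; rewrite ?eqxx //; first exact: Istep.
apply: frame_trans fm (frame_trans _ (set_frame _ _)).
by apply: frame_weaken (frame_denote _ _) => x /= ->; rewrite ?orbT.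
Qed.

Lemma exec_compile p s n : wf p -> ~~ mods 0 p -> reg s 0 = Posz n ->
  exists t, exec (compile p) s t (denote p s) /\ t <= (time p).[n]%R.
Proof.
elim: p s => [|r e|a e1 e2|p1 IH1 p2 IH2|e p1 IH1 p2 IH2|r p IH] s /=.
- by exists 1; rewrite hornerC; split=> //; apply: ExecSkip.
- by exists (cost e).+1; rewrite hornerC; split=> //; apply: ExecAssign.
- by exists (cost e1 + cost e2).+1; rewrite hornerC; split=> //; apply: ExecWrite.
- move=> /andP[wf1 wf2]; rewrite negb_or => /andP[m1 m2] s0.
  have [t1 [ex1 le1]] := IH1 s wf1 m1 s0.
  have s10 : reg (denote p1 s) 0 = Posz n by rewrite (frame_denote p1 s).1.
  have [t2 [ex2 le2]] := IH2 _ wf2 m2 s10.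
  by exists (t1 + t2); split; [apply: ExecSeq ex1 ex2 | rewrite hornerD leq_add].
- move=> /andP[wf1 wf2]; rewrite negb_or => /andP[m1 m2] s0.
  rewrite !hornerD hornerC; case: eqP => /= es.
    have [t [ex le]] := IH2 s wf2 m2 s0; exists (cost e + t).+1.
    split; first exact: ExecIfFalse.
    by rewrite -addSn addnC leq_add2r (leq_trans le) ?leq_addl.
  have [t [ex le]] := IH1 s wf1 m1 s0; exists (cost e + t).+1.
  split; first exact: ExecIfTrue.
  by rewrite -addSn addnC leq_add2r (leq_trans le) ?leq_addr.
move=> /andP[mr wfp]; rewrite negb_or => /andP[r0 m0] s0.
rewrite hornerD hornerM hornerD hornerX !hornerC s0 /=.
pose st m := iteri m (fun k s' => set_reg (denote p s') r (Posz k.+1))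
  (set_reg s r 0%R).
have st_regs k : reg (st k) r = Posz k /\ reg (st k) 0 = Posz n.
  elim: k => [|k [_ IHk]] /=; rewrite eqxx (negbTE r0) //.
  by rewrite (frame_denote p _).1.
have body k : k < n -> exists t, exec (Seq (compile p) (Assign r (succ_reg r)))
    (st k) t (st k.+1) /\ t <= (time p).[n]%R + 4.
  move=> ltk; have [rk r0k] := st_regs k.
  have [t [ex le]] := IH (st k) wfp m0 r0k; exists (t + 4).
  split; last by rewrite leq_add2r.
  apply: ExecSeq ex _.
  have -> : st k.+1 = set_reg (denote p (st k)) r (eval (denote p (st k)) (succ_reg r)).
    by rewrite /= (frame_denote p _).1 // rk addrC -PoszD.
  exact: ExecAssign.
(* Induction on the number [m] of rounds still to run. *)
have loop m : m <= n -> exists t,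
    exec (While (Leq (succ_reg r) (Reg 0)) (Seq (compile p) (Assign r (succ_reg r))))
      (st (n - m)) t (st n) /\ t <= m * ((time p).[n]%R + 10) + 6.
  elim: m => [_|m IHm ltm].
    exists 6; split=> //; rewrite subn0; apply: ExecWhileFalse => /=.
    by have [-> ->] := st_regs n; rewrite -PoszD lez_nat addn1 ltnn.
  have [t2 [ex2 le2]] := IHm (ltnW ltm).
  have lt : n - m.+1 < n by rewrite ltn_subrL /=; apply: leq_ltn_trans ltm.
  have [t1 [ex1 le1]] := body _ lt.
  exists (5 + t1 + t2).+1; split.
    apply: (ExecWhileTrue _ ex1); last by rewrite subnSK.
    by rewrite /=; have [-> ->] := st_regs (n - m.+1); rewrite -PoszD lez_nat addn1 lt.
  rewrite mulSn -[X in _ < X]addnA -addSn; apply: leq_add => //.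
  by rewrite -addSn addnC -[10]/(4 + 6) addnA leq_add2r.
have [t [ex le]] := loop n (leqnn n).
exists (2 + t); rewrite subnn in ex; split.
  by apply: ExecSeq ex; apply: ExecAssign.
change (2 + t <= n * ((time p).[n]%R + 10) + 8).
rewrite [_ + 8]addnC -[8]/(2 + 6) -addnA leq_add2l (leq_trans le) //.
by rewrite addnC leq_add2l.
Qed.

(** * The algorithm *)

Definition PThen e p := PIf e p PSkip.
Definition PUnless e p := PIf e PSkip p.
Definition pseqs := foldr PSeq PSkip.

(** By totality the two comparisons add up to 2 on equal values and to 1 otherwise. *)
Definition equal_expr e1 e2 := Defs.Sub (Add (Leq e1 e2) (Leq e2 e1)) (Const 1).

Lemma eval_equal s e1 e2 :
  eval s (equal_expr e1 e2) = (if eval s e1 == eval s e2 then 1 else 0)%R.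
Proof. by rewrite /=; case: (ltgtP (eval s e1) (eval s e2)). Qed.

(* Registers: 0, 1, 2 the input; 3 holds (n + 1)^2; 4 the first free table index;
   5 counts sweeps; 6 and 7 hold u and v; 8 runs over the vertices when u and v
   are tested; 9 and 10 record whether they are twins and whether v is pendant;
   11 to 14 are colour counts of the two blocks; 15 the answer.
   Arrays: 0 the adjacency matrix; 1 the multiples of n + 1; 2 the start of the
   table of a block; 3 marks pruned vertices; 4 to 7 the tables, one array for
   each pair of flags, with the entry for i black and j white vertices at offset
   i (n + 1) + j.  A merged block gets a fresh table, so that nothing is ever
   cleared. *)
Definition flags : seq (bool * bool) :=
  [:: (false, false); (true, false); (false, true); (true, true)].

Lemma mem_flags c : c \in flags.
Proof. by case: c => [] [] []. Qed.

Definition table (c : bool * bool) : nat :=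
  match c with
  | (false, false) => 4 | (true, false) => 5
  | (false, true) => 6 | (true, true) => 7
  end.

Lemma table_inj : injective table.
Proof. by move=> [[] []] [[] []]. Qed.

Definition edge_expr x y := Read 0 (Add (Defs.Sub (Read 1 (Reg x)) (Reg x)) (Reg y)).

Definition entry_expr cur b w := Add (Add cur (Read 1 b)) w.

(** Multiplication by n + 1 becomes a lookup, prepared by repeated addition from the initial 0. *)
Definition init_multiples :=
  PSeq (PFor 5 (PWrite 1 (succ_reg 5) (Add (Read 1 (Reg 5)) (succ_reg 0))))
       (PAssign 3 (Add (Read 1 (Reg 0)) (succ_reg 0))).

(** A single vertex is uncolored (offset 0), black (offset n + 1) or white (offset 1). *)
Definition init_block := pseqs
  [:: PWrite 2 (Reg 6) (Reg 4);
      PWrite 4 (Reg 4) (Const 1);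
      PWrite 5 (Add (Reg 4) (succ_reg 0)) (Const 1);
      PWrite 6 (succ_reg 4) (Const 1);
      PAssign 4 (Add (Reg 4) (Reg 3))].

Definition test_step :=
  PUnless (Read 3 (Reg 8)) (PUnless (equal_expr (Reg 8) (Reg 6))
    (PSeq (PThen (edge_expr 7 8) (PAssign 10 (Const 0)))
          (PUnless (equal_expr (Reg 8) (Reg 7))
             (PUnless (equal_expr (edge_expr 6 8) (edge_expr 7 8))
                (PAssign 9 (Const 0)))))).

Definition test_pair :=
  pseqs [:: PAssign 9 (Const 1); PAssign 10 (Const 1); PFor 8 test_step].

Definition sum_expr := Add (Add (Reg 4) (Add (Read 1 (Reg 11)) (Read 1 (Reg 13))))
                           (Add (Reg 12) (Reg 14)).

Definition put c1 c2 :=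
  PIf (Reg 9) (PWrite (table (join_flags true c1 c2)) sum_expr (Const 1))
              (PWrite (table (join_flags false c1 c2)) sum_expr (Const 1)).

(** The flags are constants of the program, so compatibility is settled while the program is
    generated; only incompatible flags require an edge test at run time. *)
Definition combine c1 c2 :=
  PThen (Read (table c1) (entry_expr (Read 2 (Reg 6)) (Reg 11) (Reg 12)))
    (PThen (Read (table c2) (entry_expr (Read 2 (Reg 7)) (Reg 13) (Reg 14)))
       (if compatible c1 c2 then put c1 c2 else PUnless (edge_expr 6 7) (put c1 c2))).

Definition combine_tables :=
  PFor 11 (PFor 12 (PFor 13 (PFor 14
    (pseqs [seq combine cc.1 cc.2 | cc <- [seq (c1, c2) | c1 <- flags, c2 <- flags]])))).

Definition merge_pair := PSeq combine_tables (pseqs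
  [:: PWrite 3 (Reg 7) (Const 1);
      PWrite 2 (Reg 6) (Reg 4);
      PAssign 4 (Add (Reg 4) (Reg 3))]).

(** If both tests succeed, the merge is one of twins, in accordance with [merged_twins]. *)
Definition prune_pair :=
  PUnless (equal_expr (Reg 6) (Reg 7)) (PUnless (Read 3 (Reg 6)) (PUnless (Read 3 (Reg 7))
    (PSeq test_pair (PIf (Reg 9) merge_pair (PThen (Reg 10) merge_pair))))).

Definition lookup := PFor 6 (PUnless (Read 3 (Reg 6)) (pseqs
  [seq PThen (Read (table c) (entry_expr (Read 2 (Reg 6)) (Reg 1) (Reg 2)))
             (PAssign 15 (Const 1)) | c <- flags])).

(** Counts outside [0, ..., n] could address entries outside the table of the block, so they are
    filtered out. A graph without vertices has no block to look up and admits only [b = w = 0]. *)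
Definition answer := pseqs
  [:: PAssign 15 (Const 0);
      PThen (Leq (Const 0) (Reg 1)) (PThen (Leq (Reg 1) (Reg 0))
        (PThen (Leq (Const 0) (Reg 2)) (PThen (Leq (Reg 2) (Reg 0)) lookup)));
      PThen (equal_expr (Reg 0) (Const 0)) (PThen (equal_expr (Reg 1) (Const 0))
        (PThen (equal_expr (Reg 2) (Const 0)) (PAssign 15 (Const 1))))].

Definition bw_prog := pseqs
  [:: init_multiples; PFor 6 init_block; PFor 5 (PFor 6 (PFor 7 prune_pair)); answer].

Lemma wf_bw_prog : wf bw_prog && ~~ mods 0 bw_prog.
Proof. by []. Qed.

(** * Tables in memory and how loops extend them *)

Section Memory.
Variables (n : nat) (G : sgraph 'I_n) (b w : int).
Implicit Types (s : state) (c : bool * bool).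

Let K := n.+1.

Definition fixes (L A : seq nat) s s' :=
  (forall r, r \in L -> reg s' r = reg s r) /\
  (forall a k, a \in A -> arr s' a k = arr s a k).

Lemma frame_fixes L A p s s' :
  all (fun r => ~~ mods r p) L -> all (fun a => ~~ writes a p) A ->
  frame p s s' -> fixes L A s s'.
Proof.
by move=> /allP Lp /allP Ap [rs as_]; split=> [r /Lp|a k /Ap] ?; auto.
Qed.

Record base s : Prop := Base {
  base_n : reg s 0 = Posz n;
  base_b : reg s 1 = b;
  base_w : reg s 2 = w;
  base_size : reg s 3 = Posz (K * K);
  base_adj : forall k, arr s 0 k = arr (input G b w) 0 k;
  base_mul : forall i, i <= n -> arr s 1 (Posz i) = Posz (i * K)
}.

Lemma base_fixes s s' : fixes [:: 0; 1; 2; 3] [:: 0; 1] s s' -> base s -> base s'.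
Proof.
move=> [rs as_] [s0 s1 s2 s3 s4 s5].
by split=> [||||k|i ?]; rewrite ?rs ?as_ //; apply: s5.
Qed.

(* The adjacency matrix has rows of length n, so a row starts at
   i (n + 1) - i. *)
Lemma eval_edge s x y (i j : 'I_n) : base s ->
  reg s x = Posz i -> reg s y = Posz j ->
  eval s (edge_expr x y) = (if G i j then 1 else 0)%R.
Proof.
move=> bs xi yj; rewrite /= xi yj (base_mul bs) 1?ltnW // base_adj //=.
have -> : (Posz (i * K) - Posz i + Posz j = Posz (i * n + j))%R.
  by rewrite /K mulnS addnC PoszD addrK -PoszD.
case: existsP => [[i' /existsP[j' /andP[Gij /eqP[]]]]|].
  have n0 : 0 < n by apply: leq_ltn_trans (ltn_ord i).
  move=> E; have := congr1 (divn^~ n) E; have := congr1 (modn^~ n) E.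
  rewrite !modnMDl !modn_small // !divnMDl // !divn_small // !addn0.
  by move=> /val_inj-> /val_inj->; rewrite Gij.
by case: ifP => // Gij []; exists i; apply/existsP; exists j; rewrite Gij eqxx.
Qed.

Definition nz s c (k : nat) := arr s (table c) (Posz k) <> 0%R.

(** Table entries are never cleared, so the effect of a program on the tables is the set [W] of
    entries that it sets. *)
Definition adds s (W : bool * bool -> nat -> Prop) s' :=
  forall c k, nz s' c k <-> nz s c k \/ W c k.

Definition bounded s f := forall c k, nz s c k -> k < f.

Definition holds s o (P : bool * bool -> nat -> nat -> Prop) :=
  forall c i j, i <= n -> j <= n -> nz s c (o + (i * K + j)) <-> P c i j.

Lemma adds_ext s W W' s' : (forall c k, W c k <-> W' c k) ->
  adds s W s' -> adds s W' s'.
Proof. by move=> WW' add c k; rewrite add WW'. Qed.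

Lemma adds_trans s1 s2 s3 W W' : adds s1 W s2 -> adds s2 W' s3 ->
  adds s1 (fun c k => W c k \/ W' c k) s3.
Proof. by move=> add add' c k; rewrite add' add; tauto. Qed.

Lemma adds_id s : adds s (fun _ _ => False) s.
Proof. by move=> c k; tauto. Qed.

Lemma adds_write s c e k : eval s e = Posz k ->
  adds s (fun c' k' => c' = c /\ k' = k) (denote (PWrite (table c) e (Const 1)) s).
Proof.
move=> ek c' k'; rewrite /nz /= ek; case: eqP => [/table_inj ->|tc] /=; last first.
  by split=> [|[//|[cc]]]; [left | case: tc; rewrite cc].
have [kk|kk] := eqVneq (Posz k') (Posz k); first by case: kk; split=> // _; right.
by split=> [|[//|[_ kE]]]; [left | rewrite kE eqxx in kk].
Qed.

(** Offsets are two-digit numbers in base [K]. *)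
Lemma code_lt i j : i <= n -> j <= n -> i * K + j < K * K.
Proof.
move=> iK jK; apply: (@leq_trans (i.+1 * K)); first by rewrite mulSn addnC ltn_add2r.
by rewrite leq_mul2r.
Qed.

Lemma code_inj i j i' j' : j <= n -> j' <= n -> i * K + j = i' * K + j' ->
  i = i' /\ j = j'.
Proof.
move=> jK jK' E; have := congr1 (divn^~ K) E; have := congr1 (modn^~ K) E.
by rewrite !modnMDl !modn_small // !divnMDl // !divn_small // !addn0.
Qed.

Lemma holds_adds s s' W o f P : adds s W s' -> (forall c k, W c k -> f <= k) ->
  o + K * K <= f -> holds s o P -> holds s' o P.
Proof.
move=> add ge le hold c i j iK jK; rewrite add -hold //; split=> [[//|/ge]|]; last by left.
rewrite leqNgt; case/negP; apply: leq_trans le; rewrite ltn_add2l.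
exact: code_lt.
Qed.

(** The region from [f] on is blank by [bounded], so it holds exactly what is added. *)
Lemma holds_new s s' f P :
  bounded s f ->
  adds s (fun c k => exists i j, [/\ P c i j, i <= n, j <= n & k = f + (i * K + j)]) s' ->
  holds s' f P /\ bounded s' (f + K * K).
Proof.
move=> bnd add; split=> [c i j iK jK|c k /add[/bnd lt|[i [j [_ iK jK ->]]]]].
- rewrite add; split=> [[/bnd|[i' [j' [Pij iK' jK' /addnI/code_inj]]]]|Pij].
  + by rewrite ltnNge leq_addr.
  + by move=> /(_ jK jK')[-> ->].
  + by right; exists i, j.
- exact: leq_trans lt (leq_addr _ _).
- by rewrite ltn_add2l code_lt.
Qed.

(** The step may assume that earlier rounds wrote only at [f] or beyond, hence left the older tables
    intact. *)
Lemma adds_for r p s f W : reg s 0 = Posz n ->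
  (forall k s' W', k < n -> reg s' r = Posz k -> frame (PFor r p) s s' ->
     adds s W' s' -> (forall c key, W' c key -> f <= key) ->
     adds s' (W k) (denote p s')) ->
  (forall k c key, W k c key -> f <= key) ->
  adds s (fun c key => exists2 k, k < n & W k c key) (denote (PFor r p) s).
Proof.
move=> s0 step ge.
apply: (denote_for (I := fun m s' =>
  adds s (fun c key => exists2 k, k < m & W k c key) s')) s0 _ _.
  by apply: adds_ext (adds_id s) => c key; split=> // -[].
move=> k s' ltk rk fr add.
have := adds_trans add (step k s' _ ltk rk fr add _) .
move=> /(_ (fun c key '(ex_intro2 i _ Wi) => ge i c key Wi)).
apply: adds_ext => c key; split=> [[[i lti Wi]|Wk]|[i]].
- by exists i => //; apply: ltnW.
- by exists k.
rewrite ltnS leq_eqVlt => /predU1P[->|lti] Wi; first by right.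
by left; exists i.
Qed.

End Memory.

(** * Representation of the block structure by machine states *)

Section Representation.
Variables (n : nat) (G : sgraph 'I_n) (b w : int).
Implicit Types (s : state) (c : bool * bool).

Let K := n.+1.
Let base := base G b w.
Let holds := holds n.

Lemma fixes_sub L A L' A' s s' : all (fun r => r \in L') L ->
  all (fun a => a \in A') A -> fixes L' A' s s' -> fixes L A s s'.
Proof.
by move=> /allP LL' /allP AA' [rs as_]; split=> [r /LL'|a k /AA'] ?; auto.
Qed.

Lemma adds_set_arr s a k v : (forall c, a != table c) ->
  adds s (fun _ _ => False) (set_arr s a k v).
Proof.
move=> na c k'; rewrite /nz /= eq_sym (negbTE (na c)) /=; tauto.
Qed.

Lemma holds_ext s o P Q : (forall c i j, P c i j <-> Q c i j) ->
  holds s o P -> holds s o Q.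
Proof. by move=> PQ hold c i j iK jK; rewrite hold. Qed.

Definition block_table s f (u : 'I_n) P := exists o : nat,
  [/\ arr s 2 (Posz u) = Posz o, o + K * K <= f & holds s o P].

Lemma block_table_adds s s' f f' u P W : block_table s f u P ->
  arr s' 2 (Posz u) = arr s 2 (Posz u) -> f <= f' -> adds s W s' ->
  (forall c k, W c k -> f <= k) -> block_table s' f' u P.
Proof.
move=> [o [ou ofr hold]] same ff' add ge; exists o; split; first by rewrite same.
  exact: leq_trans ff'.
exact: holds_adds add ge ofr hold.
Qed.

(** The sets [H u] and [S u] themselves are not stored; memory reflects them only through the tables
    of [feasible]. *)
Record represents (R : {set 'I_n}) H S f s : Prop := Represents {
  repr_base : base s;
  repr_fresh : reg s 4 = Posz f;
  repr_alive : forall v : 'I_n, arr s 3 (Posz v) = 0%R <-> v \in R;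
  repr_bounded : bounded s f;
  repr_table : forall u, u \in R -> block_table s f u (feasible G (H u) (S u));
  repr_blocks : blocks G R H S
}.

Lemma repr_fixes R H S f s s' :
  fixes [:: 0; 1; 2; 3; 4] [:: 0; 1; 2; 3; 4; 5; 6; 7] s s' ->
  represents R H S f s -> represents R H S f s'.
Proof.
move=> [rs as_] [bs s4 al bd tb bl].
have nzE c k : nz s' c k <-> nz s c k.
  by rewrite /nz as_ //; case: c => [] [] [].
split=> //.
- by apply: base_fixes bs; apply: fixes_sub (conj rs as_).
- by rewrite rs.
- by move=> v; rewrite as_.
- by move=> c k /nzE/bd.
move=> u /tb[o [ou ofr hold]]; exists o; split; rewrite ?as_ //.
by move=> c i j iK jK; rewrite nzE hold.
Qed.

Lemma init_multiplesP (s := denote init_multiples (input G b w)) :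
  [/\ base s, reg s 4 = 0%R & forall a k, 1 < a -> arr s a k = 0%R].
Proof.
have fr := frame_denote init_multiples (input G b w).
set p := PFor 5 (PWrite 1 (succ_reg 5) (Add (Read 1 (Reg 5)) (succ_reg 0))).
have mulE : forall i, i <= n -> arr (denote p (input G b w)) 1 (Posz i) = Posz (i * K).
  apply: (denote_for (n := n) (I := fun k s => forall i, i <= k ->
    arr s 1 (Posz i) = Posz (i * K))) => // [[]//|k s1 ltk k5 [rs _] IH j].
  rewrite /= k5 rs // /input /= -PoszD addn1.
  rewrite leq_eqVlt => /predU1P[->|].
    by rewrite eqxx IH // -!PoszD mulSn addn1 addnC.
  rewrite ltnS => lek; case: eqP => [[jk]|_]; last exact: IH.
  by rewrite jk ltnn in lek.
split.
- split=> //; try (by rewrite fr.1); last by move=> k; rewrite fr.2.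
  have r0 : reg (denote p (input G b w)) 0 = Posz n by rewrite (frame_denote p _).1.
  transitivity (arr (denote p (input G b w)) 1 (reg (denote p (input G b w)) 0)
    + (reg (denote p (input G b w)) 0 + 1))%R; first by [].
  by rewrite r0 mulE // -!PoszD addn1 /K mulSn addnC.
- by rewrite fr.1.
by move=> a k a1; rewrite fr.2 /input /=; case: a a1 => [|[|a]].
Qed.

Lemma initP (s := denote (PFor 6 init_block) (denote init_multiples (input G b w))) :
  represents setT set1 set1 (n * (K * K)) s.
Proof.
have [base0 fresh0 arr0] := init_multiplesP.
pose leafP c i j := (c, i, j) \in
  [:: (false, false, 0, 0); (true, false, 1, 0); (false, true, 0, 1)].
have I : [/\ reg s 4 = Posz (n * (K * K)), bounded s (n * (K * K))
    & forall u : 'I_n, u < n -> block_table s (n * (K * K)) u leafP].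
  apply: (denote_for (I := fun m s => [/\ reg s 4 = Posz (m * (K * K)), bounded s (m * (K * K))
    & forall u : 'I_n, u < m -> block_table s (m * (K * K)) u leafP]) (base_n base0)).
    split=> //.
    by move=> c k []; apply: arr0; case: c => [] [] [].
  move=> k s1 ltk k6 fr [fresh bnd tabs]; set f := k * (K * K) in fresh bnd tabs *.
  have base1 : base s1 by apply: base_fixes base0; apply: frame_fixes fr.
  set s2 := set_reg _ _ _.
  have fE : f + K * K = k.+1 * (K * K) by rewrite mulSn addnC.
  have add : adds s1 (fun c key => exists i j,
      [/\ leafP c i j, i <= n, j <= n & key = f + (i * K + j)]) s2.
    have add1 : adds s1 (fun _ _ => False) (denote (PWrite 2 (Reg 6) (Reg 4)) s1).
      by apply: adds_set_arr; case=> [] [] [].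
    set t1 := denote _ _ in add1.
    have fresh1 : reg t1 4 = Posz f by [].
    have n1 : reg t1 0 = Posz n by apply: base_n base1.
    have add2 := adds_write (false, false) (fresh1 : eval t1 (Reg 4) = Posz f).
    have E3 : eval t1 (Add (Reg 4) (succ_reg 0)) = Posz (f + K).
      by rewrite /= fresh1 n1 -!PoszD addn1.
    have E4 : eval t1 (succ_reg 4) = Posz (f + 1) by rewrite /= fresh1.
    set t2 := denote _ _ in add2.
    have add3 := adds_write (s := t2) (true, false) (e := Add (Reg 4) (succ_reg 0)) E3.
    set t3 := denote _ _ in add3.
    have add4 := adds_write (s := t3) (false, true) (e := succ_reg 4) E4.
    apply: (adds_ext _ (adds_trans (adds_trans (adds_trans add1 add2) add3) add4)).
    (* The entries for one colored vertex need the index 1 to be at most [n]. *)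
    have n0 : 0 < n by apply: leq_ltn_trans ltk.
    move=> c key; rewrite /leafP; split.
      case=> [[[[]|]|]|] [-> ->].
      - by exists 0, 0; split; rewrite // mul0n !addn0.
      - by exists 1, 0; split; rewrite // mul1n addn0.
      - by exists 0, 1; split; rewrite // mul0n.
    case=> i [j []]; rewrite !inE => /or3P[] /eqP[-> -> ->] _ _ ->.
    - by left; left; right; rewrite mul0n !addn0.
    - by left; right; rewrite mul1n addn0.
    - by right.
  have [hold bnd'] := holds_new bnd add.
  rewrite -fE; split=> //.
  - by rewrite /s2 /= fresh (base_size base1).
  move=> u; rewrite ltnS leq_eqVlt => /predU1P[uk|ltu].
    exists f; split=> //.
    by rewrite /s2 /= uk k6 eqxx fresh.
  apply: block_table_adds (tabs u ltu) _ (leq_addr _ _) add _.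
    rewrite /s2 /= k6; case: eqP => // -[uk]; by rewrite uk ltnn in ltu.
  by move=> c key [i [j [_ _ _ ->]]]; apply: leq_addr.
case: I => fresh bnd tabs.
have fr := frame_denote (PFor 6 init_block) (denote init_multiples (input G b w)).
split=> //.
- by apply: base_fixes base0; apply: frame_fixes fr.
- by move=> v; rewrite fr.2 // arr0 // inE.
- move=> u _; have [o [ou ofr hold]] := tabs u (ltn_ord u); exists o; split=> //.
  by apply: holds_ext hold => c i j; rewrite feasible_singleton.
exact: blocks_singletons.
Qed.

End Representation.

(** * The tests for twins and leaves *)

Section Steps.
Variables (n : nat) (G : sgraph 'I_n) (b w : int).
Implicit Types (s : state) (c : bool * bool).

Let base := base G b w.
Let represents := represents G b w.

Lemma all_ltS k (ltk : k < n) (P : 'I_n -> Prop) :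
  (forall x : 'I_n, x < k.+1 -> P x) <->
  (forall x : 'I_n, x < k -> P x) /\ P (Ordinal ltk).
Proof.
split=> [H|[H Pk] x]; first by split=> [x lt|]; apply: H; rewrite // ltnW.
rewrite ltnS leq_eqVlt => /predU1P[xk|]; last exact: H.
by rewrite (_ : x = Ordinal ltk) //; apply: val_inj.
Qed.

Lemma test_stepE s (u v x : 'I_n) : base s ->
  reg s 6 = Posz u -> reg s 7 = Posz v -> reg s 8 = Posz x ->
  denote test_step s =
    if (arr s 3 (Posz x) != 0%R) || (x == u) then s
    else let s' := if G v x then set_reg s 10 0%R else s in
    if (x == v) || (G u x == G v x) then s' else set_reg s' 9 0%R.
Proof.
move=> bs s6 s7 s8; rewrite /test_step /PUnless /PThen.
have neq0 (B : bool) : ((if B then 1 else 0 : int) != 0)%R = B by case: B.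
have denote_if e p1 p2 t : denote (PIf e p1 p2) t =
  if eval t e != 0%R then denote p1 t else denote p2 t by [].
have denote_seq p1 p2 t : denote (PSeq p1 p2) t = denote p2 (denote p1 t) by [].
rewrite !denote_if denote_seq !denote_if eval_equal neq0.
set s' := if eval s (edge_expr 7 8) != 0%R then _ else _.
have s'E : s' = if G v x then set_reg s 10 0%R else s.
  by rewrite /s' (eval_edge bs s7 s8) neq0.
have bs' : base s'.
  rewrite s'E; case: ifP => // _.
  apply: base_fixes bs; apply: frame_fixes (frame_denote (PAssign 10 (Const 0)) s) => //.
have s'6 : reg s' 6 = Posz u by rewrite s'E; case: ifP.
have s'7 : reg s' 7 = Posz v by rewrite s'E; case: ifP.
have s'8 : reg s' 8 = Posz x by rewrite s'E; case: ifP.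
rewrite !eval_equal !neq0 (eval_edge bs' s'6 s'8) (eval_edge bs' s'7 s'8).
have -> : eval s (Read 3 (Reg 8)) = arr s 3 (Posz x) by rewrite /= s8.
have -> : (eval s (Reg 8) == eval s (Reg 6)) = (x == u) by rewrite /= s8 s6.
have -> : (eval s' (Reg 8) == eval s' (Reg 7)) = (x == v) by rewrite /= s'8 s'7.
have -> : ((if G u x then 1 else 0 : int) == (if G v x then 1 else 0))%R = (G u x == G v x).
  by case: (G u x); case: (G v x).
rewrite /= -s'E; case: (arr s 3 _ != _) => //=; case: (x == u) => //=.
by case: (x == v).
Qed.

Lemma test_pairP R H S f s (u v : 'I_n) (s' := denote test_pair s) :
  represents R H S f s -> reg s 6 = Posz u -> reg s 7 = Posz v ->
  (reg s' 9 <> 0%R <-> twins G R u v) /\ (reg s' 10 <> 0%R <-> leaf G R u v).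
Proof.
move=> is_ s6 s7.
pose I k s1 :=
  (reg s1 9 <> 0%R <-> forall x : 'I_n, x < k -> x \in R -> x != u -> x != v ->
     G u x = G v x) /\
  (reg s1 10 <> 0%R <-> forall x : 'I_n, x < k -> x \in R -> x != u -> ~~ G v x).
have [I9 I10] : I n s'.
  pose s0 := set_reg (set_reg s 9 1%R) 10 1%R.
  apply: (denote_for (I := I) (s := s0) (p := test_step) (base_n (repr_base is_))).
    by split; split=> [_ x|_].
  move=> k s1 ltk s18 fr [I9 I10].
  have is1 : represents R H S f s1.
    have : represents R H S f s0.
      apply: repr_fixes is_.
      by apply: frame_fixes (frame_denote
        (PSeq (PAssign 9 (Const 1)) (PAssign 10 (Const 1))) s).
    by apply: repr_fixes; apply: frame_fixes fr.
  have {}s6 : reg s1 6 = Posz u by rewrite fr.1.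
  have {}s7 : reg s1 7 = Posz v by rewrite fr.1.
  pose x := Ordinal ltk; have {}s18 : reg s1 8 = Posz x by [].
  rewrite /I !(all_ltS ltk) -I9 -I10 -/x {I I9 I10}.
  have al := repr_alive is1 x; have bs := repr_base is1.
  rewrite (test_stepE bs s6 s7 s18) /=.
  have [xR|xR] := boolP (x \in R); last first.
    have -> : (arr s1 3 (Posz k) == 0%R) = false.
      by apply/eqP => /al; rewrite (negbTE xR).
    by split; split=> [?|[]].
  have -> : arr s1 3 (Posz k) == 0%R by apply/eqP/al.
  case: (eqVneq x u) => [xu|xu] /=; first by split; split=> [?|[]].
  (* The leaf test is also run on [v] itself, which passes it by irreflexivity. *)
  case: (eqVneq x v) => [xv|xv] /=.
    by rewrite xv adj_irr; split; split=> [?|[]].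
  by case: (G v x); case: (G u x) => /=; split; split=> [h|[h1 h2]] //;
    have := h2 isT isT => // /(_ isT).
split; [rewrite I9 | rewrite I10].
  by split=> [tw|/twinsP tw x _]; [apply/twinsP => x; apply: tw | apply: tw].
split=> [lf|/forall_inP lf x _ xR xu]; last exact: (implyP (lf x xR)).
by apply/forall_inP => x xR; apply/implyP; apply: lf.
Qed.

End Steps.

(** * Computing the table of a merged block *)

Section Combining.
Variables (n : nat) (G : sgraph 'I_n) (b w : int).
Implicit Types (s : state) (c : bool * bool).

Let K := n.+1.
Let base := base G b w.
Let holds := holds n.

Variables (u v : 'I_n) (ou ov f : nat) (tw : bool).
Variables (P1 P2 : bool * bool -> nat -> nat -> Prop).

(** Everything the four nested loops read and leave unchanged. *)
Record context s : Prop := Context {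
  ctx_base : base s;
  ctx_fresh : reg s 4 = Posz f;
  ctx_u : reg s 6 = Posz u;
  ctx_v : reg s 7 = Posz v;
  ctx_tw : reg s 9 <> 0%R <-> tw;
  ctx_ou : arr s 2 (Posz u) = Posz ou;
  ctx_ov : arr s 2 (Posz v) = Posz ov;
  ctx_P1 : holds s ou P1;
  ctx_P2 : holds s ov P2
}.

Hypotheses (ouf : ou + K * K <= f) (ovf : ov + K * K <= f).

Lemma context_adds s s' W : fixes [:: 0; 1; 2; 3; 4; 6; 7; 9] [:: 0; 1; 2] s s' ->
  adds s W s' -> (forall c k, W c k -> f <= k) -> context s -> context s'.
Proof.
move=> fx add ge [bs s4 su sv stw au av hu hv].
have [rs as_] := fx; split; rewrite ?rs ?as_ //.
- by apply: base_fixes bs; apply: fixes_sub fx.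
- exact: holds_adds add ge ouf hu.
- exact: holds_adds add ge ovf hv.
Qed.

Definition combination i1 j1 i2 j2 (cc : (bool * bool) * (bool * bool)) c k :=
  [/\ P1 cc.1 i1 j1, P2 cc.2 i2 j2, G u v -> compatible cc.1 cc.2,
      c = join_flags tw cc.1 cc.2 & k = f + ((i1 + i2) * K + (j1 + j2))].

Lemma combine_adds s i1 j1 i2 j2 c1 c2 : context s ->
  i1 < n -> j1 < n -> i2 < n -> j2 < n ->
  reg s 11 = Posz i1 -> reg s 12 = Posz j1 -> reg s 13 = Posz i2 -> reg s 14 = Posz j2 ->
  adds s (combination i1 j1 i2 j2 (c1, c2)) (denote (combine c1 c2) s).
Proof.
move=> [bs s4 su sv stw au av hu hv] i1n j1n i2n j2n s11 s12 s13 s14.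
have none : ~ (exists c k, combination i1 j1 i2 j2 (c1, c2) c k) ->
    adds s (combination i1 j1 i2 j2 (c1, c2)) s.
  move=> no; apply: adds_ext (adds_id s) => c k; split=> // H.
  by case: no; exists c, k.
have denote_if e p1 p2 t : denote (PIf e p1 p2) t =
  if eval t e != 0%R then denote p1 t else denote p2 t by [].
have mulE i : i < n -> arr s 1 (Posz i) = Posz (i * K).
  by move=> lt; rewrite (base_mul bs) // ltnW.
rewrite /combine /PThen !denote_if.
have -> : eval s (Read (table c1) (entry_expr (Read 2 (Reg 6)) (Reg 11) (Reg 12))) =
    arr s (table c1) (Posz (ou + (i1 * K + j1))).
  by rewrite /= su au s11 s12 mulE // -!PoszD addnA.
have -> : eval s (Read (table c2) (entry_expr (Read 2 (Reg 7)) (Reg 13) (Reg 14))) =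
    arr s (table c2) (Posz (ov + (i2 * K + j2))).
  by rewrite /= sv av s13 s14 mulE // -!PoszD addnA.
have hu' := hu c1 i1 j1 (ltnW i1n) (ltnW j1n).
have hv' := hv c2 i2 j2 (ltnW i2n) (ltnW j2n).
case: eqP => [no1|/hu' yes1] /=.
  by apply: none => -[c [k [/hu'/(_ no1)]]].
case: eqP => [no2|/hv' yes2] /=.
  by apply: none => -[c [k [_ /hv'/(_ no2)]]].
have sumE : eval s sum_expr = Posz (f + ((i1 + i2) * K + (j1 + j2))).
  by rewrite /= s4 s11 s12 s13 s14 !mulE // -!PoszD mulnDl [in RHS]addnA.
have putE : (G u v -> compatible c1 c2) ->
    adds s (combination i1 j1 i2 j2 (c1, c2)) (denote (put c1 c2) s).
  move=> comp; rewrite /put denote_if.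
  have -> : (eval s (Reg 9) != 0%R) = tw by apply/idP/idP => [/eqP/stw|/stw/eqP].
  rewrite /combination; case: (tw);
    by apply: adds_ext (adds_write _ sumE) => c k; split=> [[-> ->]|[]].
case: ifP => [comp|ncomp]; first exact: putE.
rewrite /PUnless denote_if (eval_edge bs su sv); case Guv: (G u v) => /=.
  by apply: none => -[c [k [_ _ /(_ Guv)]]]; rewrite ncomp.
by apply: putE; rewrite Guv.
Qed.

Definition pairs := [seq (c1, c2) | c1 <- flags, c2 <- flags].

Lemma combines_adds s i1 j1 i2 j2 : context s ->
  i1 < n -> j1 < n -> i2 < n -> j2 < n ->
  reg s 11 = Posz i1 -> reg s 12 = Posz j1 -> reg s 13 = Posz i2 -> reg s 14 = Posz j2 ->
  adds s (fun c k => exists cc, combination i1 j1 i2 j2 cc c k)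
    (denote (pseqs [seq combine cc.1 cc.2 | cc <- pairs]) s).
Proof.
move=> ctx i1n j1n i2n j2n s11 s12 s13 s14.
have : adds s (fun c k => exists2 cc, cc \in pairs & combination i1 j1 i2 j2 cc c k)
    (denote (pseqs [seq combine cc.1 cc.2 | cc <- pairs]) s).
  elim: pairs s ctx s11 s12 s13 s14 => [|[c1 c2] l IH] s ctx s11 s12 s13 s14 /=.
    by apply: adds_ext (adds_id s) => c k; split=> // -[].
  have add := combine_adds c1 c2 ctx i1n j1n i2n j2n s11 s12 s13 s14.
  have fr := frame_denote (combine c1 c2) s.
  have fx : fixes [:: 0; 1; 2; 3; 4; 6; 7; 9; 11; 12; 13; 14] [:: 0; 1; 2] s
      (denote (combine c1 c2) s).
    by apply: frame_fixes fr; case: (c1) => [] [] []; case: (c2) => [] [] [].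
  have [rs _] := fx.
  have ctx' : context (denote (combine c1 c2) s).
    apply: context_adds add _ ctx; first exact: fixes_sub fx.
    by move=> c k [_ _ _ _ ->]; apply: leq_addr.
  have := adds_trans add (IH _ ctx' _ _ _ _); rewrite !rs // => /(_ s11 s12 s13 s14).
  apply: adds_ext => c k; split=> [[H|[cc ccl H]]|[cc]].
  - by exists (c1, c2); rewrite ?inE ?eqxx.
  - by exists cc; rewrite // inE ccl orbT.
  by rewrite inE => /predU1P[->|ccl] H; [left | right; exists cc].
apply: adds_ext => c k; split=> [[cc _ H]|[[c1 c2] H]]; first by exists cc.
by exists (c1, c2) => //; apply: allpairs_f; apply: mem_flags.
Qed.

Lemma combine_tables_adds s : context s ->
  adds s (fun c k => exists2 i1, i1 < n & exists2 j1, j1 < n &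
      exists2 i2, i2 < n & exists2 j2, j2 < n &
      exists cc, combination i1 j1 i2 j2 cc c k)
    (denote combine_tables s).
Proof.
have ge i1 j1 i2 j2 cc c k : combination i1 j1 i2 j2 cc c k -> f <= k.
  by case=> _ _ _ _ ->; apply: leq_addr.
have ctx_n t : context t -> reg t 0 = Posz n by case=> -[].
move=> ctx; apply: (adds_for (f := f)) (ctx_n _ ctx) _ _; last first.
  by move=> i1 c k [j1 _ [i2 _ [j2 _ [cc /ge]]]].
move=> i1 s1 W1 i1n s1_11 fr1 add1 ge1.
have {}ctx : context s1 by apply: context_adds add1 ge1 ctx; apply: frame_fixes fr1.
apply: (adds_for (f := f)) (ctx_n _ ctx) _ _; last by move=> j1 c k [i2 _ [j2 _ [cc /ge]]].
move=> j1 s2 W2 j1n s2_12 fr2 add2 ge2.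
have {}ctx : context s2 by apply: context_adds add2 ge2 ctx; apply: frame_fixes fr2.
have s2_11 : reg s2 11 = Posz i1 by rewrite fr2.1.
apply: (adds_for (f := f)) (ctx_n _ ctx) _ _; last by move=> i2 c k [j2 _ [cc /ge]].
move=> i2 s3 W3 i2n s3_13 fr3 add3 ge3.
have {}ctx : context s3 by apply: context_adds add3 ge3 ctx; apply: frame_fixes fr3.
have s3_11 : reg s3 11 = Posz i1 by rewrite fr3.1.
have s3_12 : reg s3 12 = Posz j1 by rewrite fr3.1.
apply: (adds_for (f := f)) (ctx_n _ ctx) _ _; last by move=> j2 c k [cc /ge].
move=> j2 s4 W4 j2n s4_14 fr4 add4 ge4.
have {}ctx : context s4 by apply: context_adds add4 ge4 ctx; apply: frame_fixes fr4.
by apply: combines_adds => //; rewrite fr4.1.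
Qed.

End Combining.

(** * Correctness of merging, sweeping and answering *)

Section Correctness.
Local Arguments denote : simpl never.
Variables (n : nat) (G : sgraph 'I_n) (b w : int).
Implicit Types (s : state) (c : bool * bool).

Let K := n.+1.
Let represents := represents G b w.

Lemma merge_pairP R H S f s (u v : 'I_n) :
  represents R H S f s -> reg s 6 = Posz u -> reg s 7 = Posz v ->
  (reg s 9 <> 0%R <-> twins G R u v) -> prunable G R u v ->
  represents (R :\ v) (merged_block H u v) (merged_twins G R S u v) (f + K * K)
    (denote merge_pair s).
Proof.
move=> [bs s4 al bnd tabs bl] su sv stw uvP.
have /and4P[uR vR uv _] := uvP.
have [ou [au ouf hu]] := tabs u uR; have [ov [av ovf hv]] := tabs v vR.
have ctx : context G b w u v ou ov f (twins G R u v)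
  (feasible G (H u) (S u)) (feasible G (H v) (S v)) s by [].
have := combine_tables_adds ouf ovf ctx.
have fr := frame_denote combine_tables s.
have frm := frame_denote merge_pair s.
have : denote merge_pair s =
  let s1 := denote combine_tables s in
  set_reg (set_arr (set_arr s1 3 (reg s1 7) 1%R) 2 (reg s1 6) (reg s1 4)) 4
    (reg s1 4 + reg s1 3)%R by [].
move: (denote combine_tables s) (denote merge_pair s) fr frm => s1 s2 fr frm /= s2E add.
have s1r r : ~~ mods r combine_tables -> reg s1 r = reg s r by apply: fr.1.
have nzE c k : nz s2 c k <-> nz s1 c k by rewrite s2E; case: c => [] [] [].
(* By [feasible_merge] the loops produce the feasible pairs of the merged block;
   [feasible_merge_bound] shows that no summand escapes their ranges. *)
have {}add : adds s (fun c k => exists i j,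
    [/\ feasible G (merged_block H u v u) (merged_twins G R S u v u) c i j,
        i <= n, j <= n & k = f + (i * K + j)]) s2.
  move=> c k; rewrite nzE; move: c k; apply: adds_ext add => c k; split.
    case=> i1 _ [j1 _ [i2 _ [j2 _ [cc [f1 f2 comp cE ->]]]]].
    exists (i1 + i2), (j1 + j2).
    have [_] := feasible_merge_bound bl uvP f1 f2; rewrite card_ord => -[iK jK].
    split=> //; apply/(feasible_merge bl uvP).
    by exists cc.1, cc.2, i1, j1, i2, j2.
  case=> i [j [/(feasible_merge bl uvP)[c1 [c2 [i1 [j1 [i2 [j2 []]]]]]]]].
  move=> f1 f2 [-> ->] comp -> _ _ ->.
  have [[]] := feasible_merge_bound bl uvP f1 f2; rewrite card_ord => ? ? ? ? _.
  by exists i1 => //; exists j1 => //; exists i2 => //; exists j2 => //; exists (c1, c2).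
have [hold bnd'] := holds_new bnd add.
have fE : reg s2 4 = Posz (f + K * K).
  by rewrite s2E /= !s1r // s4 (base_size bs).
have curE x : arr s2 2 (Posz x) = if x == u :> nat then Posz f else arr s 2 (Posz x).
  by rewrite s2E /= !s1r // su s4 fr.2.
split=> //.
- by apply: base_fixes bs; apply: frame_fixes frm.
- move=> x; rewrite !inE.
  have -> : arr s2 3 (Posz x) = if x == v then 1%R else arr s 3 (Posz x).
    by rewrite s2E /= !s1r // sv fr.2.
  by case: eqP => //= _; rewrite al.
- move=> x; rewrite !inE => /andP[xv xR].
  have [->|xu] := eqVneq x u; first by exists f; rewrite curE eqxx.
  have := block_table_adds (tabs x xR) _ (leq_addr (K * K) f) add.
  rewrite /merged_block /merged_twins (negbTE xu); apply.
    by rewrite curE -[x == u :> nat]/(x == u) (negbTE xu).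
  by move=> c k [i [j [_ _ _ ->]]]; apply: leq_addr.
exact: blocks_merge.
Qed.

Definition prune R u v := if prunable G R u v then R :\ v else R.

Lemma prune_pairP R H S f s (u v : 'I_n) :
  represents R H S f s -> reg s 6 = Posz u -> reg s 7 = Posz v ->
  exists H' S' f', represents (prune R u v) H' S' f' (denote prune_pair s).
Proof.
move=> rep su sv.
have denote_if e p1 p2 t : denote (PIf e p1 p2) t =
  if eval t e != 0%R then denote p1 t else denote p2 t by [].
have denote_seq p1 p2 t : denote (PSeq p1 p2) t = denote p2 (denote p1 t) by [].
rewrite /prune_pair /PUnless /PThen !denote_if eval_equal /= su sv.
have neq0 (B : bool) : ((if B then 1 else 0 : int) != 0)%R = B by case: B.
rewrite neq0 -[Posz u == Posz v]/(u == v) /prune /prunable.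
case: (eqVneq u v) => [uv|uv]; first by rewrite !andbF; exists H, S, f.
have al := repr_alive rep.
case: eqP => [/al uR|nu] /=; last first.
  have -> : u \in R = false by apply/negP => /al.
  by exists H, S, f.
case: eqP => [/al vR|nv] /=; last first.
  have -> : v \in R = false by apply/negP => /al.
  by rewrite andbF; exists H, S, f.
rewrite uR vR /=; have [tw lf] := test_pairP rep su sv.
rewrite denote_seq.
have fr := frame_denote test_pair s; set s1 := denote test_pair s in tw lf fr *.
have rep1 : represents R H S f s1 by apply: repr_fixes rep; apply: frame_fixes fr.
have su1 : reg s1 6 = Posz u by rewrite fr.1.
have sv1 : reg s1 7 = Posz v by rewrite fr.1.
have merge pr := merge_pairP rep1 su1 sv1 tw pr.
rewrite !denote_if; case: eqP => [n9|/tw yes] /=; last first.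
  by rewrite yes /=; do 3 eexists; apply: merge; rewrite /prunable uR vR uv yes.
have -> : twins G R u v = false by apply/negP => /tw.
case: eqP => [n10|/lf yes] /=; last first.
  by rewrite yes /=; do 3 eexists; apply: merge; rewrite /prunable uR vR uv yes orbT.
have -> : leaf G R u v = false by apply/negP => /lf.
by exists H, S, f.
Qed.

Lemma repr_set_reg R H S f s r v : 4 < r -> represents R H S f s ->
  represents R H S f (set_reg s r v).
Proof.
move=> r4; apply: repr_fixes; split=> // r' /=; case: eqP => // ->.
by rewrite !inE; case: r r4 => [|[|[|[|[|r]]]]].
Qed.

Definition sweep := PFor 6 (PFor 7 prune_pair).

Hypothesis dh : distance_hereditary G.

(** A sweep that prunes nothing has tested every pair against the same [R], so [prunable_exists]
    leaves at most one vertex. The vertex [u] of a pruned pair survives, so [R'] is never empty. *)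
Lemma sweepP R H S f s : represents R H S f s -> 0 < #|R| ->
  exists R' H' S' f', [/\ represents R' H' S' f' (denote sweep s), 0 < #|R'|
    & (#|R'| < #|R|) || (#|R'| <= 1)].
Proof.
move=> rep R0.
pose J i j s := exists R' H' S' f', [/\ represents R' H' S' f' s, R' \subset R, 0 < #|R'|
  & R' = R -> forall u v : 'I_n, u < i \/ u = i :> nat /\ v < j -> ~~ prunable G R u v].
have setJ i j s' r v : 4 < r -> J i j s' -> J i j (set_reg s' r v).
  move=> r4 [R' [H' [S' [f' [rep' sub R'0 checked]]]]]; exists R', H', S', f'; split=> //.
  exact: repr_set_reg.
have J_n i j s' : J i j s' -> reg s' 0 = Posz n.
  by case=> R' [H' [S' [f' [[[]]]]]].
have [R' [H' [S' [f' [rep' sub R'0 checked]]]]] : J n 0 (denote sweep s).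
  apply: (denote_for (I := fun i => J i 0)); first exact: base_n (repr_base rep).
    apply: (setJ) => //; exists R, H, S, f; split=> // _ u v []; first by rewrite ltn0.
    by case.
  move=> i s1 lti s1i _ J1; apply: (setJ) => //.
  have : J i n (denote (PFor 7 prune_pair) s1).
    apply: (denote_for (I := J i)); [exact: J_n J1 | exact: (setJ) |].
    move=> j s2 ltj s2j [rs _] [R' [H' [S' [f' [rep' sub R'0 checked]]]]].
    apply: (setJ) => //.
    have s2i : reg s2 6 = Posz (Ordinal lti) by rewrite rs.
    have s2j' : reg s2 7 = Posz (Ordinal ltj) by rewrite s2j.
    have [H2 [S2 [f2 rep2]]] := prune_pairP rep' s2i s2j'.
    exists (prune R' (Ordinal lti) (Ordinal ltj)), H2, S2, f2; split=> //.
    - by rewrite /prune; case: ifP => // _; apply: subset_trans (subsetDl _ _) sub.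
    - rewrite /prune; case: ifP => // /and4P[uR' vR' uv _].
      by apply/card_gt0P; exists (Ordinal lti); rewrite !inE uv.
    rewrite /prune; case: ifP => [/and4P[uR' vR' uv _] E|npr E].
      (* Once a vertex is removed, the current set can no longer equal [R]. *)
      have := subsetP sub _ vR'; rewrite -E !inE eqxx //.
    move=> u v; case=> [lt|[ui]]; first by apply: (checked) => //; left.
    rewrite ltnS leq_eqVlt => /predU1P[vj|lt]; last by apply: (checked) => //; right.
    have -> : u = Ordinal lti by apply: val_inj.
    have -> : v = Ordinal ltj by apply: val_inj.
    by rewrite -E npr.
  case=> R' [H' [S' [f' [rep' sub R'0 checked]]]]; exists R', H', S', f'; split=> //.
  move=> E u v [|[_]]; last by rewrite ltn0.
  rewrite ltnS leq_eqVlt => /predU1P[ui|lt]; last by apply: (checked) => //; left.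
  by apply: (checked) => //; right; split.
exists R', H', S', f'; split=> //.
have := subset_leq_card sub; rewrite leq_eqVlt => /predU1P[cE|->//].
apply/orP; right; rewrite leqNgt; apply/negP => R2.
have RE : R' = R by apply/eqP; rewrite eqEcard sub cE /=.
have [u [v pr]] := prunable_exists dh R2.
by move: pr; rewrite RE (negbTE (checked RE u v _)) //; left.
Qed.

Definition sweeps_state :=
  denote (PFor 5 sweep) (denote (PFor 6 init_block) (denote init_multiples (input G b w))).

Lemma sweepsP : exists R H S f,
  represents R H S f sweeps_state /\ (0 < n -> #|R| = 1).
Proof.
have rep0 := initP G b w.
(* Each sweep removes a vertex until one is left. The premise [0 < n] sets aside the graph without
   vertices, where [R] is empty. *)
pose J k s := exists R H S f, [/\ represents R H S f s, 0 < n -> 0 < #|R|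
  & (#|R| + k <= n) || (#|R| <= 1)].
have setJ k s r v : 4 < r -> J k s -> J k (set_reg s r v).
  move=> r4 [R [H [S [f [rep R0 le]]]]]; exists R, H, S, f; split=> //.
  exact: repr_set_reg.
have [R [H [S [f [rep R0 le]]]]] : J n sweeps_state.
  apply: (denote_for (I := J)); first exact: base_n (repr_base rep0).
    apply: (setJ) => //; exists setT, set1, set1, (n * (K * K)).
    by split; rewrite ?cardsT ?card_ord ?addn0 ?leqnn.
  move=> k s ltk _ _ [R [H [S [f [rep R0 le]]]]]; apply: (setJ) => //.
  have n0 : 0 < n by apply: leq_ltn_trans ltk.
  have [R' [H' [S' [f' [rep' R'0 lt]]]]] := sweepP rep (R0 n0).
  exists R', H', S', f'; split=> //.
  case/orP: lt => [lt|->]; last by rewrite orbT.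
  case/orP: le => le; last by move: R'0; rewrite lt0n; move: (leq_trans lt le); case: #|R'|.
  by apply/orP; left; apply: leq_trans le; rewrite addnS -addSn leq_add2r.
exists R, H, S, f; split=> // n0; have {R0}R0 := R0 n0.
apply/eqP; rewrite eqn_leq R0 andbT; case/orP: le => // le.
by move: R0; rewrite -(ltn_add2r n) add0n ltnNge le.
Qed.

Lemma probesP (l : seq (bool * bool)) s (e := entry_expr (Read 2 (Reg 6)) (Reg 1) (Reg 2)) :
  reg (denote (pseqs [seq PThen (Read (table c) e) (PAssign 15 (Const 1)) | c <- l]) s) 15
    <> 0%R <->
  reg s 15 <> 0%R \/ exists2 c, c \in l & eval s (Read (table c) e) <> 0%R.
Proof.
elim: l s => [|c l IH] s; first by split=> [|[|[]]] //; left.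
pose s' := if eval s (Read (table c) e) != 0%R then set_reg s 15 1%R else s.
have -> : denote (pseqs [seq PThen (Read (table c) e) (PAssign 15 (Const 1)) | c <- c :: l]) s =
  denote (pseqs [seq PThen (Read (table c) e) (PAssign 15 (Const 1)) | c <- l]) s' by [].
rewrite IH /s'; case: eqP => [no|yes] /=.
  split=> [[?|[c' cl nzc]]|[?|[c']]]; [by left | | by left |].
    by right; exists c'; rewrite // inE cl orbT.
  by rewrite inE => /predU1P[-> /(_ no)//|cl nzc]; right; exists c'.
split=> _; last by left.
by right; exists c; rewrite ?inE ?eqxx.
Qed.

Lemma lookupP R H S f s (u : 'I_n) (b' w' : nat) : represents R H S f s ->
  R = [set u] -> b = Posz b' -> w = Posz w' -> b' <= n -> w' <= n -> reg s 15 = 0%R ->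
  reg (denote lookup s) 15 <> 0%R <-> exists c, feasible G (H u) (S u) c b' w'.
Proof.
move=> rep RE bE wE b'n w'n s15.
have ne1 : (1 <> 0 :> int)%R by [].
(* [u] is the only vertex left, so the answer is settled once the loop has passed it. *)
pose I k s := reg s 15 <> 0%R <-> u < k /\ exists c, feasible G (H u) (S u) c b' w'.
have : I n (denote lookup s).
  apply: (denote_for (I := I)); first exact: base_n (repr_base rep).
    by rewrite /I; split=> [|[]].
  move=> k s1 ltk s1k fr.
  have {}rep : represents R H S f s1 by apply: repr_fixes rep; apply: frame_fixes fr.
  set p := PUnless _ _; rewrite /I.
  have -> : reg (set_reg (denote p s1) 6 (Posz k.+1)) 15 = reg (denote p s1) 15 by [].
  have -> : denote p s1 = if arr s1 3 (reg s1 6) != 0%R then s1 else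
      denote (pseqs [seq PThen (Read (table c) (entry_expr (Read 2 (Reg 6)) (Reg 1) (Reg 2)))
             (PAssign 15 (Const 1)) | c <- flags]) s1 by [].
  rewrite {}/p s1k -[Posz k]/(Posz (Ordinal ltk)).
  case: ifP => [/eqP no|/negbFE/eqP/(repr_alive rep) kR] IH.
    rewrite IH [u < k.+1]ltnS [u <= k]leq_eqVlt.
    split=> [[-> ?]|[/predU1P[uk|//] ?]]; first by rewrite orbT.
    case: no; have -> : Ordinal ltk = u by apply: val_inj.
    apply/(repr_alive rep).
    by rewrite RE inE.
  move: kR; rewrite RE inE => /eqP uk.
  have uR : u \in R by rewrite RE inE.
  have [o [cu _ hold]] := repr_table rep uR.
  have bs := repr_base rep.
  rewrite probesP IH; split.
    case=> [[lt _]|[c _ nzc]]; first by rewrite -uk /= ltnn in lt.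
    split; first by rewrite -uk.
    exists c; rewrite -hold //; move: nzc.
    rewrite /nz /= s1k -[Posz k]/(Posz (Ordinal ltk)) uk cu (base_b bs) (base_w bs) bE wE.
    by rewrite (base_mul bs) // -!PoszD addnA.
  case=> _ [c]; rewrite -hold // => nzc; right; exists c; first exact: mem_flags.
  move: nzc.
  rewrite /nz /= s1k -[Posz k]/(Posz (Ordinal ltk)) uk cu (base_b bs) (base_w bs) bE wE.
  by rewrite (base_mul bs) // -!PoszD addnA.
by rewrite /I => ->; split=> [[]|H0] //; split.
Qed.

Lemma coloring_bounds B W : bw_coloring G b w B W ->
  exists b' w', [/\ b = Posz b', w = Posz w', b' <= n & w' <= n].
Proof.
case=> _ bE wE _; exists #|B|, #|W|; split=> //.
  by rewrite -[n in _ <= n]card_ord max_card.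
by rewrite -[n in _ <= n]card_ord max_card.
Qed.

Lemma answerP R H S f s : represents R H S f s -> (0 < n -> #|R| = 1) ->
  reg (denote answer s) 15 <> 0%R <-> exists B W, bw_coloring G b w B W.
Proof.
move=> rep R1; have bs := repr_base rep.
have denote_if e p1 p2 t : denote (PIf e p1 p2) t =
  if eval t e != 0%R then denote p1 t else denote p2 t by [].
have denote_seq p1 p2 t : denote (PSeq p1 p2) t = denote p2 (denote p1 t) by [].
have neq0 (B : bool) : ((if B then 1 else 0 : int) != 0)%R = B by case: B.
have leqE t e1 e2 : eval t (Leq e1 e2) = (if eval t e1 <= eval t e2 then 1 else 0)%R by [].
have regE t r : eval t (Reg r) = reg t r by [].
rewrite /answer /pseqs /= !denote_seq; set s1 := denote (PAssign _ _) s.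
have rep1 : represents R H S f s1 by apply: repr_set_reg rep.
have bs1 := repr_base rep1; have s1_15 : reg s1 15 = 0%R by [].
set q := PThen _ _; set p := PThen _ _.
have -> : denote PSkip (denote q (denote p s1)) = denote q (denote p s1) by [].
have pE : denote p s1 =
    if (0 <= b <= Posz n)%R && (0 <= w <= Posz n)%R then denote lookup s1 else s1.
  rewrite /p /PThen !denote_if !leqE !neq0 !regE (base_n bs1) (base_b bs1) (base_w bs1).
  by case: (0 <= b)%R; case: (b <= _)%R; case: (0 <= w)%R; case: (w <= _)%R.
have bs2 : base G b w (denote p s1).
  by apply: base_fixes bs1; apply: frame_fixes (frame_denote p s1).
have qE : denote q (denote p s1) =
    if [&& n == 0, b == 0%R & w == 0%R] then set_reg (denote p s1) 15 1%R else denote p s1.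
  move: (denote p s1) bs2 => s2 bs2.
  rewrite /q /PThen !denote_if !eval_equal !neq0 !regE (base_n bs2) (base_b bs2) (base_w bs2).
  rewrite -[Posz n == _]/(n == 0).
  by case: (n == 0); case: (b == _)%R; case: (w == _)%R.
rewrite qE; have [n0|n0] := eqVneq n 0 => /=.
  (* The lookup loop runs no round, so register 15 keeps its initial 0. *)
  have p0 : reg (denote p s1) 15 = 0%R.
    rewrite pE; case: ifP => // _.
    by apply: (denote_for (n := 0) (I := fun _ s => reg s 15 = 0%R)); rewrite // (base_n bs1) n0.
  case: ifP => [/andP[/eqP bE /eqP wE]|no].
    split=> // _; exists set0, set0; rewrite bE wE; split; rewrite ?cards0 //.
      by rewrite disjoints_subset sub0set.
    by move=> x y; rewrite inE.
  split=> [|[B [W /coloring_bounds[b' [w' [bE wE]]]]]]; first by rewrite p0.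
  rewrite n0 !leqn0 => /eqP b0 /eqP w0.
  by move: no; rewrite bE wE b0 w0.
have {}R1 : #|R| = 1 by apply: R1; rewrite lt0n.
have /cards1P[u RE] : #|R| == 1 by rewrite R1.
rewrite pE; case: ifP => [/andP[/andP[b0 bn] /andP[w0 wn]]|no].
  have bE : b = Posz `|b|%N by rewrite gez0_abs.
  have wE : w = Posz `|w|%N by rewrite gez0_abs.
  have bn' : `|b|%N <= n by rewrite -lez_nat -bE.
  have wn' : `|w|%N <= n by rewrite -lez_nat -wE.
  rewrite (lookupP rep1 RE bE wE bn' wn' s1_15).
  by rewrite (feasible_last _ _ (repr_blocks rep) RE) -bE -wE.
split=> [|[B [W /coloring_bounds[b' [w' [bE wE bn wn]]]]]]; first by rewrite s1_15.
by move: no; rewrite bE wE !lez_nat bn wn.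
Qed.

End Correctness.

Theorem theorem5 :
  exists (A : cmd) (q : {poly nat}),
    forall (n : nat) (G : sgraph 'I_n) (b w : int),
      distance_hereditary G ->
      exists (t : nat) (s : state),
        [/\ exec A (input G b w) t s,
            t <= q.[n]%R
          & accepting s <-> exists B W : {set 'I_n}, bw_coloring G b w B W].
Proof.
(* Register 0 bounds every loop and must keep [n], so the answer is moved there only at the end, at
   cost 2. *)
exists (Seq (compile bw_prog) (Assign 0 (Reg 15))), (time bw_prog + 2%:P)%R.
move=> n G b w dh; have /andP[wfp m0] := wf_bw_prog.
have [t [ex le]] := exec_compile (s := input G b w) wfp m0 (erefl (Posz n)).
exists (t + 2), (set_reg (denote bw_prog (input G b w)) 0
  (eval (denote bw_prog (input G b w)) (Reg 15))); split.
- exact: ExecSeq ex (ExecAssign _ _ _).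
- by rewrite hornerD hornerC leq_add2r.
have [R [H [S [f [rep R1]]]]] := sweepsP b w dh.
exact: answerP rep R1.
Qed.
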